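(* (i) Every $n\in\mathbb{N}$ can be written as $n=x^2+y^2+z^2+w^2$ with $x,y,z,w\in\mathbb{Z}$ such that $w(x+y+z+2w)=0$. (ii) Let $\lambda\in\{1,2\}$ and $m\in\{2,3\}$. Then every $n\in\mathbb{N}$ can be written as $n=x^2+y^2+z^2+w^2$ with $x,y,z,w\in\mathbb{Z}$ such that $x+y+z+2w=\lambda r^m$ for some $r\in\mathbb{N}$. (iii) Every $n\in\mathbb{N}$ can be written as $n=x^2+y^2+z^2+w^2$ with $x,y,z,w\in\mathbb{Z}$ such that $w(x+2y+3z)=0$. (iv) Let $\lambda\in\{1,2,4\}$ and $m\in\{2,3\}$. Then every $n\in\mathbb{N}$ can be written as $n=x^2+y^2+z^2+w^2$ with $x,y,z,w\in\mathbb{Z}$ such that $x+2y+3z=\lambda r^m$ for some $r\in\mathbb{N}$.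
   Context: $\mathbb{N}=\{0,1,2,\ldots\}$. *)

(* Defs.v *)
From mathcomp Require Export all_boot all_order all_algebra.

#[export] Set Implicit Arguments.
#[export] Unset Strict Implicit.
#[export] Unset Printing Implicit Defensive.

(* Main.v *)
Require Import Defs.
From mathcomp Require Import all_boot all_order all_algebra.
From mathcomp Require Import all_fingroup cyclic finfield.
From mathcomp Require Import zify ring lra.
Import Order.TTheory GRing.Theory Num.Theory.
Local Open Scope ring_scope.

(** If [7 n - s ^ 2] is a sum of three squares, then [7 n] is the norm of a quaternion with real
    part [s]; permuting and changing signs of its imaginary coordinates makes it divisible by
    [2 + i + j + k] up to units, and the quotient gives [n = x^2 + y^2 + z^2 + w^2] with
    [x + y + z + 2 w = s].  Applied to [2 n] this yields the analogous statement for
    [x + 2 y + 3 z = s] and [14 n - s ^ 2].  Everything then follows from the theorem of Legendre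
    and Gauss on sums of three squares, with explicit choices of [s] for [n = 4 ^ k c].

    The three squares theorem is proved without Dirichlet's theorem on primes.  For squarefree [n]
    it suffices to find [m] coprime to [n] such that [- n] is a square modulo [m] and [- m] is a
    square modulo [n]: this produces a unimodular positive ternary form representing [n].
    Let [chi] be the product of the local characters at the primes dividing the discriminant, so
    that [chi p = (- n / p)] by quadratic reciprocity, and let [r = 1 * chi].  Weighting
    [r m] by [prod_i (f_i m ^ 2 + eps_i f_i m)] picks out the [m] with prescribed local characters.
    Expanding the product, the two subsets of characters giving [1] and [chi] contribute
    the sum of [r], which exceeds any multiple of [Y] for [m <= Y ^ 2] because [r >= 1]
    at the values of [x ^ 2 + n y ^ 2]; all the others are [O(Y)] by the hyperbola method. *)

(** * Unimodular ternary forms *)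

Definition sum3sq (c : int) : Prop := exists x y z : int, c = x ^+ 2 + y ^+ 2 + z ^+ 2.

Lemma sum3sqM (k c : int) : sum3sq c -> sum3sq (k ^+ 2 * c).
Proof.
case=> x [y [z ->]]; exists (k * x), (k * y), (k * z); ring.
Qed.

Lemma nearest_multiple (a f : int) : 0 < a -> exists k : int, `|2 * (f + k * a)| <= a.
Proof.
move=> a0; exists (- ((2 * f + a) %/ (2 * a))%Z).
have := divz_eq (2 * f + a) (2 * a).
have := modz_ge0 (2 * f + a) (_ : 2 * a != 0).
have := ltz_pmod (2 * f + a) (_ : 0 < 2 * a).
move: ((2 * f + a) %/ (2 * a))%Z ((2 * f + a) %% (2 * a))%Z => q r.
move=> /(_ ltac:(lia)) h1 /(_ ltac:(lia)) h2 h3.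
have -> : 2 * (f + - q * a) = r - a by nia.
lia.
Qed.

Lemma posdef_snd_gt0 (a b f : int) : 0 < a -> 0 < a * b - f ^+ 2 -> 0 < b.
Proof.
move=> a0 h; rewrite -(pmulr_rgt0 _ a0); apply: lt_le_trans h _.
by rewrite gerBl sqr_ge0.
Qed.

Lemma reduced_binary_bound (a b f : int) : 0 < a -> a <= b -> `|2 * f| <= a ->
  3 * a ^+ 2 <= 4 * (a * b - f ^+ 2).
Proof.
move=> a0 ab hf.
have : (2 * f) ^+ 2 <= a ^+ 2.
  by rewrite -[_ ^+ 2]real_normK ?num_real // lerXn2r ?nnegrE ?normr_ge0 // ltW.
have : a * a <= a * b by rewrite ler_pM2l.
lia.
Qed.

(** If [u >= 2], then [3 u ^ 2 >= 4 u + 4] forces [v > u], whereas [3 v ^ 2 >= 4 v - 1] forces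
    [u >= v]. *)
Lemma mutually_bounded_eq1 (u v : int) : 0 < u -> 0 < v ->
  3 * u ^+ 2 <= 4 * v -> 3 * v ^+ 2 <= 4 * u -> u = 1.
Proof.
move=> u0 v0 uv vu; suff : ~ 1 < u by lia.
move=> u1.
have : 0 <= (u - 2) * (3 * u + 2) by apply: mulr_ge0; lia.
have : 0 <= (v - 1) * (3 * v - 1) by apply: mulr_ge0; lia.
lia.
Qed.

(* Gauss's descent: reducing the leading binary form and the leading binary form of the
   adjoint in turn yields [3 a ^ 2 <= 4 (a b - f ^ 2)] and [3 (a b - f ^ 2) ^ 2 <= 4 a],
   which force both to be 1. *)
Lemma unimodular_ternary_sum3sq (a b c d e f : int) :
  0 < a -> 0 < a * b - f ^+ 2 ->
  a * b * c + 2 * d * e * f - a * d ^+ 2 - b * e ^+ 2 - c * f ^+ 2 = 1 ->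
  forall x y z : int,
  sum3sq (a * x ^+ 2 + b * y ^+ 2 + c * z ^+ 2
          + 2 * d * y * z + 2 * e * x * z + 2 * f * x * y).
Proof.
have [N] := ubnP `|(a + (a * b - f ^+ 2))%R|%N.
elim: N a b c d e f => // N IH a b c d e f hN a0 A0 det1 x y z.
have [k hk] := nearest_multiple f a0.
(* Coefficients after substituting [x + k y] for [x]. If [b1 < a], exchanging the first two
   variables lowers the measure. *)
pose f1 := f + k * a; pose b1 := b + 2 * k * f + k ^+ 2 * a.
have A1 : a * b1 - f1 ^+ 2 = a * b - f ^+ 2 by rewrite /b1 /f1; ring.
have [b1a|ab1] := ltP b1 a.
  have b10 : 0 < b1 by apply: (@posdef_snd_gt0 a b1 f1) => //; rewrite A1.
  have := IH b1 a c e (d + k * e) f1 _ b10.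
  rewrite [b1 * a]mulrC A1 => /(_ _ A0) H.
  have := H _ _ y (x - k * y) z.
  rewrite [X in sum3sq X](_ : _ = a * x ^+ 2 + b * y ^+ 2 + c * z ^+ 2
          + 2 * d * y * z + 2 * e * x * z + 2 * f * x * y); last by rewrite /b1 /f1; ring.
  apply; first by lia.
  by rewrite -[RHS]det1 /b1 /f1; ring.
have a2 := reduced_binary_bound a0 ab1 hk; rewrite A1 in a2.
pose A := a * b - f ^+ 2; rewrite -/A in A0 a2 hN.
have [l hl] := nearest_multiple (a * d - e * f) A0.
(* Substituting [y + l z] for [y] translates the binary form of minors [A, D1, C1], whose
   determinant is [a] times the ternary determinant 1. *)
pose D1 := a * d - e * f + l * A; rewrite -/D1 in hl.
pose C1 := a * c - e ^+ 2 + 2 * l * (a * d - e * f) + l ^+ 2 * A.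
have AC : A * C1 - D1 ^+ 2 = a by transitivity (a * (a * b * c + 2 * d * e * f - a * d ^+ 2 - b * e ^+ 2 - c * f ^+ 2)); last (by rewrite det1 mulr1); rewrite /C1 /D1 /A; ring.
have [C1A|AC1] := ltP C1 A.
  have C10 : 0 < C1 by apply: (@posdef_snd_gt0 A C1 D1) => //; rewrite AC.
  pose c1 := c + 2 * l * d + l ^+ 2 * b; pose e1 := e + l * f.
  have C1E : a * c1 - e1 ^+ 2 = C1 by rewrite /c1 /e1 /C1 /A; ring.
  have := IH a c1 b (d + l * b) f e1 _ a0; rewrite C1E.
  move=> /(_ _ C10) H.
  have := H _ _ x z (y - l * z).
  rewrite [X in sum3sq X](_ : _ = a * x ^+ 2 + b * y ^+ 2 + c * z ^+ 2
          + 2 * d * y * z + 2 * e * x * z + 2 * f * x * y); last by rewrite /c1 /e1; ring.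
  apply; first by move: hN C1A a0 A0 C10; clear; lia.
  by rewrite -[RHS]det1 /c1 /e1; ring.
have A2 := reduced_binary_bound A0 AC1 hl; rewrite AC in A2.
have a1 : a = 1 := mutually_bounded_eq1 a0 A0 a2 A2.
have A1' : A = 1 := mutually_bounded_eq1 A0 a0 A2 a2.
move: A1' det1; rewrite /A a1 !mul1r => A1' det1.
(* Both leading minors are 1, so completing the square twice gives the three squares. *)
clear -A1' det1; exists (x + f * y + e * z), (y + (d - e * f) * z), z.
have -> : b = 1 + f ^+ 2 by lia.
have -> : c = 1 + e ^+ 2 + (d - e * f) ^+ 2.
  by move: det1; have -> : b = 1 + f ^+ 2 by [lia]; move=> det1; lia.
ring.
Qed.

(* The last column of the unimodular Gram matrix is [(1, 0, n)]; completing it amounts to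
   finding [M = b n - 1] such that [- n] is a square modulo [M]. *)
Lemma sum3sq_criterion (n m t u : int) : 0 < n -> 0 < m -> coprimez m n ->
  (m %| t ^+ 2 + n)%Z -> (n %| u ^+ 2 + m)%Z -> sum3sq n.
Proof.
move=> n0 m0 cmn /dvdzP[M1 hM1] /dvdzP[v hv].
have /coprimezP[[al be] /= bez] := cmn.
(* An inverse of [u] modulo [n], since [- u ^ 2 = m] and [al * m = 1] there. *)
pose k := - (al * u).
have ku : k * u = 1 - n * (al * v + be).
  have -> : n * (al * v + be) = al * (v * n) + be * n by ring.
  have -> : be * n = 1 - al * m by rewrite -bez; ring.
  by rewrite -hv /k; ring.
(* By Chinese remainders [T] is [t] modulo [m] and [m * k] modulo [n]. The latter yields
   [M = m * k ^ 2 = - 1] modulo [n]. *)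
pose s := al * (m * k - t); pose T := t + m * s; pose M := M1 + 2 * t * s + m * s ^+ 2.
have TM : T ^+ 2 + n = m * M.
  have -> : T ^+ 2 + n = t ^+ 2 + n + m * (2 * t * s + m * s ^+ 2) by rewrite /T; ring.
  by rewrite hM1 /M; ring.
have M0 : 0 < M.
  by rewrite -(pmulr_rgt0 _ m0) -TM ltr_wpDl // sqr_ge0.
have TE : T = m * k - n * (be * (m * k - t)).
  have -> : T = t + (al * m) * (m * k - t) by rewrite /T /s; ring.
  have -> : al * m = 1 - be * n by rewrite -bez; ring.
  ring.
have : (n %| M + 1)%Z.
  rewrite -(@Gauss_dvdzr n m) 1?coprimez_sym // mulrDr mulr1 -TM.
  have -> : T ^+ 2 + n + m = m * (m * k ^+ 2 + 1)
    + n * (1 - 2 * m * k * be * (m * k - t) + n * (be * (m * k - t)) ^+ 2).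
    rewrite TE; ring.
  apply: rpredD; last exact: dvdz_mulr.
  apply: dvdz_mull.
  have -> : m = v * n - u ^+ 2 by rewrite -hv; ring.
  have -> : (v * n - u ^+ 2) * k ^+ 2 + 1 = n * (v * k ^+ 2) - ((k * u) ^+ 2 - 1) by ring.
  rewrite ku; apply: rpredB; first exact: dvdz_mulr.
  have -> : (1 - n * (al * v + be)) ^+ 2 - 1 = n * ((al * v + be) * (n * (al * v + be) - 2)).
    ring.
  exact: dvdz_mulr.
case/dvdzP=> b hb.
have b0 : 0 < b by rewrite -(pmulr_lgt0 _ n0) -hb addrC ltr_wpDr // ltW.
(* Chosen so that the leading minor [a * M - (T * b) ^ 2] is [b]; the determinant is then
   [b * n - M = 1]. *)
pose a := b ^+ 2 * m - b.
have aM : a * M - (T * b) ^+ 2 = b.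
  have -> : a * M - (T * b) ^+ 2 = b ^+ 2 * (m * M) - b * M - T ^+ 2 * b ^+ 2 by rewrite /a; ring.
  have -> : M = b * n - 1 by rewrite -hb; ring.
  have -> : m * (b * n - 1) = T ^+ 2 + n by rewrite -hb TM; ring.
  ring.
have a0 : 0 < a.
  rewrite -(pmulr_lgt0 _ M0) -(subrK ((T * b) ^+ 2) (a * M)) aM.
  by rewrite ltr_wpDr // sqr_ge0.
have det1 : a * M * n + 2 * 0 * 1 * (T * b) - a * 0 ^+ 2 - M * 1 ^+ 2 - n * (T * b) ^+ 2 = 1.
  have -> : a * M * n + 2 * 0 * 1 * (T * b) - a * 0 ^+ 2 - M * 1 ^+ 2 - n * (T * b) ^+ 2
    = (a * M - (T * b) ^+ 2) * n - M by ring.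
  by rewrite aM -hb; ring.
have := @unimodular_ternary_sum3sq a M n 0 1 (T * b) a0 _ det1 0 0 1.
rewrite aM => /(_ b0); congr sum3sq; ring.
Qed.

(** * Legendre symbols and quadratic reciprocity *)

(** Euler's criterion serves as the definition, with values lifted to [int]. For odd prime [p], the
    last branch is the case where the power is [-1]. *)
Definition legendre (p : nat) (a : int) : int :=
  let x : 'F_p := a%:~R in if x == 0 then 0 else if x ^+ p./2 == 1 then 1 else -1.

Section Legendre.
Variable p : nat.
Hypotheses (p_pr : prime p) (p_odd : odd p).

Lemma dvdz_Fp (a : int) : (p %| a)%Z = (a%:~R == 0 :> 'F_p).
Proof. exact: dvdz_pcharf (pchar_Fp p_pr) a. Qed.

Lemma Fp_one_neq_opp : (1 : 'F_p) != -1.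
Proof.
rewrite -subr_eq0 opprK -[1 + 1]/((2 : int)%:~R : 'F_p) -dvdz_Fp.
have := prime_gt1 p_pr; apply: contraL => /dvdn_leq /= h; have {h}/h := isT.
by case: p p_odd => [|[|[|[|]]]].
Qed.

Lemma Fp_pow_half (x : 'F_p) : x != 0 -> (x ^+ p./2 == 1) || (x ^+ p./2 == -1).
Proof.
move=> x0; rewrite -subr_eq0 -[X in _ || X]subr_eq0 opprK -mulf_eq0 -subr_sqr expr1n subr_eq0.
rewrite -exprM muln2; apply/eqP/(mulfI x0); rewrite -exprS.
have -> : (p./2.*2).+1 = p by rewrite -[RHS]odd_double_half p_odd.
by rewrite mulr1; have := expf_card x; rewrite (card_Fp p_pr).
Qed.

Lemma legendre_Fp (a : int) : (legendre p a)%:~R = (a%:~R : 'F_p) ^+ p./2.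
Proof.
rewrite /legendre; case: eqVneq => [->|a0].
  by rewrite expr0n; case: p p_pr p_odd => [|[|[|]]].
have := Fp_pow_half a0; case: eqVneq => [->//|_ /= /eqP ->].
by rewrite mulrN1z.
Qed.

Lemma legendre_val (a : int) : legendre p a \in [:: 0; 1; -1].
Proof. by rewrite /legendre; do 2![case: ifP => //]. Qed.

Lemma sign_inj (e f : int) : e \in [:: 0; 1; -1] -> f \in [:: 0; 1; -1] ->
  e%:~R = f%:~R :> 'F_p -> e = f.
Proof.
have n1 := oner_neq0 'F_p; have n2 := Fp_one_neq_opp.
have n3 : -1 != 0 :> 'F_p by rewrite oppr_eq0.
rewrite !inE => /or3P[]/eqP-> /or3P[]/eqP-> //=; rewrite ?mulrN1z ?mulr1z ?mulr0z => /eqP;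
  by rewrite ?(negPf n1) ?(negPf n2) ?(negPf n3) // eq_sym ?(negPf n1) ?(negPf n2) ?(negPf n3).
Qed.

Lemma legendreM (a b : int) : legendre p (a * b) = legendre p a * legendre p b.
Proof.
apply: sign_inj; first exact: legendre_val.
  by have := legendre_val a; have := legendre_val b;
     rewrite !inE => /or3P[]/eqP-> /or3P[]/eqP->.
by rewrite rmorphM /= !legendre_Fp rmorphM exprMn.
Qed.

Lemma legendre_mod (a b : int) : (p %| a - b)%Z -> legendre p a = legendre p b.
Proof.
by rewrite dvdz_Fp rmorphB subr_eq0 /legendre => /eqP ->.
Qed.

Lemma legendre_eq0 (a : int) : (legendre p a == 0) = (p %| a)%Z.
Proof. by rewrite dvdz_Fp /legendre; case: ifP => //; case: ifP. Qed.

Lemma legendre1 : legendre p 1 = 1.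
Proof. by rewrite /legendre oner_eq0 expr1n eqxx. Qed.

Lemma legendre_sqr (a : int) : ~~ (p %| a)%Z -> legendre p (a ^+ 2) = 1.
Proof.
rewrite -legendre_eq0 expr2 legendreM.
by have := legendre_val a; rewrite !inE => /or3P[]/eqP->.
Qed.

(** If [g] generates the cyclic unit group and [g ^ k] is killed by [(p - 1) / 2], then [k] is
    even. *)
Lemma legendre_sqrt (a : int) : legendre p a = 1 -> exists t : int, (p %| t ^+ 2 - a)%Z.
Proof.
rewrite /legendre; case: eqVneq => // a0; case: eqVneq => // a1 _.
have ua : (a%:~R : 'F_p) \is a GRing.unit by rewrite unitfE.
pose u : {unit 'F_p} := FinRing.Unit ua.
have /cyclicP[g Eg] := field_unit_group_cyclic [set: {unit 'F_p}]%G.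
have og : #[g]%g = p.-1 by rewrite /order -Eg card_finField_unit card_Fp.
have /cycleP[k Ek] : u \in <[g]>%g by rewrite -Eg inE.
have hp : p.-1 = (p./2 * 2)%N by rewrite muln2 -[in LHS](odd_double_half p) p_odd.
have : (g ^+ (k * p./2) == 1)%g.
  by rewrite expgM -Ek; apply/eqP/val_inj; rewrite FinRing.val_unitX.
rewrite -order_dvdn og hp mulnC dvdn_pmul2r; last first.
  by case: p p_pr p_odd => [|[|[|]]].
case/dvdnP=> j Ej; exists (val (val (g ^+ j)%g) : nat)%:Z.
rewrite dvdz_Fp rmorphB rmorphXn /= subr_eq0.
have -> : (Posz (val (val (g ^+ j)%g)))%:~R = val (g ^+ j)%g :> 'F_p by rewrite -pmulrn natr_Zp.
by rewrite -FinRing.val_unitX -expgM -Ej -Ek.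
Qed.

End Legendre.

(** * Gauss's lemma, Eisenstein's lattice points and reciprocity *)

Section GaussLemma.
Variables p a : nat.
Hypotheses (p_pr : prime p) (p_odd : odd p) (pa : ~~ (p %| a)%N).
Local Notation h := p./2.

Let residue (i : nat) : nat := ((a * i.+1) %% p)%N.
Let large (i : nat) : bool := (h < residue i)%N.
(** Absolute value of the least absolute residue of [a * i.+1], lowered by one to be an index below
    [h]. *)
Let folded (i : nat) : nat := if large i then (p - residue i).-1 else (residue i).-1.

Let p_half : p = h.*2.+1. Proof. by rewrite -[LHS]odd_double_half p_odd. Qed.

Lemma dvdn_Fp (m : nat) : (m%:R == 0 :> 'F_p) = (p %| m)%N.
Proof. by rewrite pmulrn -(dvdz_Fp p_pr). Qed.

Let index_neq0 (i : 'I_h) : (i.+1%:R != 0 :> 'F_p).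
Proof.
rewrite dvdn_Fp; apply: contraL (ltn_ord i) => /dvdn_leq /= /(_ isT).
by rewrite -leqNgt; move: p_half; lia.
Qed.

Let residue_gt0 (i : 'I_h) : (0 < residue i)%N.
Proof.
rewrite lt0n -/(dvdn p _) Euclid_dvdM // negb_or pa /=.
by rewrite -dvdn_Fp index_neq0.
Qed.

Let residue_lt (i : nat) : (residue i < p)%N.
Proof. by rewrite ltn_mod prime_gt0. Qed.

Let folded_lt (i : 'I_h) : (folded i < h)%N.
Proof.
have := residue_gt0 i; have := residue_lt i; rewrite /folded /large.
move: (residue i) => r r1 r2; have ph := p_half; clear -r1 r2 ph.
by move: r1 r2 ph; case: ifP => h1; lia.
Qed.

Let fold (i : 'I_h) : 'I_h := Ordinal (folded_lt i).

Let residue_Fp (i : nat) : (residue i)%:R = a%:R * i.+1%:R :> 'F_p.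
Proof.
by rewrite /residue -natrM {2}(divn_eq (a * i.+1) p) natrD natrM (pchar_Fp_0 p_pr) mulr0 add0r.
Qed.

Let fold_Fp (i : 'I_h) : a%:R * i.+1%:R = (-1) ^+ large i * (fold i).+1%:R :> 'F_p.
Proof.
have := residue_gt0 i; have := residue_lt i; rewrite -residue_Fp /= /folded.
case: (large i) => h1 h2; last by rewrite prednK ?mul1r.
by rewrite prednK ?subn_gt0 // natrB 1?ltnW // (pchar_Fp_0 p_pr) sub0r expr1 mulN1r opprK.
Qed.

(** Equal folds make [i.+1] and [j.+1] equal up to sign in ['F_p]. Opposite signs are impossible as
    [0 < i.+1 + j.+1 < p]. *)
Let fold_inj : injective fold.
Proof.
move=> i j eqij.
have : (a%:R * i.+1%:R : 'F_p) ^+ 2 = (a%:R * j.+1%:R) ^+ 2.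
  by rewrite !fold_Fp eqij !exprMn !sqrr_sign.
have an0 : a%:R != 0 :> 'F_p by rewrite dvdn_Fp.
move/eqP; rewrite eqf_sqr -mulrN !(inj_eq (mulfI an0)) => /orP[].
  wlog le_ij : i j {eqij} / (i <= j)%N.
    move=> W; case: (leqP i j) => [/W //|/ltnW/W W'].
    by rewrite eq_sym => /W'.
  rewrite eq_sym -subr_eq0 -natrB // dvdn_Fp subSS => d.
  apply/val_inj/eqP => /=; rewrite eqn_leq le_ij /= -subn_eq0.
  move: d; case: (j - i)%N (ltn_ord j) (leq_subr i j) => // k hj kj /dvdn_leq /= /(_ isT).
  by move: p_half; lia.
rewrite -subr_eq0 opprK -natrD dvdn_Fp => /dvdn_leq.
by move: p_half (ltn_ord i) (ltn_ord j); lia.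
Qed.

(** The product of all [a * i.+1] is both [a ^ h] times [h] factorial and, [fold] being a
    permutation, a sign times [h] factorial. *)
Lemma gauss_lemma :
  legendre p a%:Z = (-1) ^+ (\sum_(i < h) (h < (a * i.+1) %% p))%N.
Proof.
apply: (sign_inj p_pr p_odd); first exact: legendre_val.
  by rewrite -signr_odd; case: odd.
rewrite legendre_Fp // rmorphXn rmorphN /=.
have Pn0 : \prod_(i < h) (i.+1%:R : 'F_p) != 0.
  by apply/prodf_neq0 => i _; apply: index_neq0.
apply: (mulIf Pn0); rewrite -pmulrn.
have -> : (a%:R : 'F_p) ^+ h = \prod_(i < h) a%:R by rewrite prodr_const card_ord.
rewrite -big_split /= (eq_bigr _ (fun i _ => fold_Fp i)) big_split /=; congr (_ * _).
  by rewrite -prodrXr.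
by rewrite [RHS](reindex_inj fold_inj).
Qed.

(** Modulo 2, with [a] and [p] odd, [i.+1] is the quotient plus the residue, and the residue is
    [large i] plus [(fold i).+1]. Summing over [i] cancels the permuted indices. *)
Lemma legendre_eisenstein : odd a ->
  legendre p a%:Z = (-1) ^+ (\sum_(i < h) (a * i.+1) %/ p)%N.
Proof.
move=> a_odd; rewrite gauss_lemma -signr_odd -[RHS]signr_odd; congr (_ ^+ _).
congr nat_of_bool.
have odd_sum (F : 'I_h -> nat) : odd (\sum_i F i)%N = \big[addb/false]_i odd (F i).
  exact: (big_morph odd oddD).
rewrite !odd_sum.
have E : \big[addb/false]_(i < h) odd i.+1 = \big[addb/false]_(i < h) odd (fold i).+1.
  by rewrite [LHS](reindex_inj fold_inj).
rewrite -[RHS]addbF -[X in _ (+) X](addbb (\big[addb/false]_(i < h) odd i.+1)) {2}E.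
rewrite -!big_split /=; apply: eq_bigr => i _.
have := congr1 odd (divn_eq (a * i.+1) p); rewrite oddM oddD oddM a_odd p_odd andbT /=.
rewrite -/(residue i) -/(large i); have := residue_gt0 i; have := residue_lt i.
rewrite /folded; case: (large i) => h1 h2 /=; rewrite ?oddB 1?ltnW //; last first.
  by case: (residue i) h2 => //= k _ ->; case: odd; case: odd.
have -> : odd (p - residue i).-1 = odd (residue i).
  by rewrite -subnS oddB //= p_odd; case: odd.
by move=> ->; case: odd; case: odd.
Qed.

End GaussLemma.

Lemma sum_leq_multiples (p N k : nat) : (0 < p)%N -> (N %/ p <= k)%N ->
  (\sum_(j < k) (p * j.+1 <= N) = N %/ p)%N.
Proof.
move=> p0 hk; rewrite (eq_bigr (fun j : 'I_k => ((j < N %/ p)%N : nat))); last first.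
  by move=> j _; rewrite mulnC leq_divRL.
rewrite -(subnKC hk) big_split_ord /= -[RHS]addn0; congr (_ + _)%N.
  by rewrite (eq_bigr (fun=> 1%N)) ?sum1_card ?card_ord // => i _; rewrite ltn_ord.
by rewrite big1 // => i _; rewrite ltnNge leq_addr.
Qed.

(** The two Eisenstein sums count the lattice points of a [p./2] by [q./2] rectangle on either side
    of its diagonal, which contains none of them. *)
Lemma quadratic_reciprocity (p q : nat) : prime p -> prime q -> odd p -> odd q -> p != q ->
  legendre p q%:Z * legendre q p%:Z = (-1) ^+ (p./2 * q./2).
Proof.
move=> p_pr q_pr p_odd q_odd pq.
have npq : ~~ (p %| q)%N by rewrite dvdn_prime2.
have nqp : ~~ (q %| p)%N by rewrite dvdn_prime2 // eq_sym.
have p2 : p = p./2.*2.+1 by rewrite -[LHS]odd_double_half p_odd.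
have q2 : q = q./2.*2.+1 by rewrite -[LHS]odd_double_half q_odd.
rewrite !legendre_eisenstein // -exprD; congr (_ ^+ _).
have half_bound (u v i : nat) : u = u./2.*2.+1 -> v = v./2.*2.+1 -> (i < u./2)%N ->
    ((v * i.+1) %/ u <= v./2)%N.
  move=> hu hv ih; rewrite -ltnS ltn_divLR; last by rewrite hu.
  move: i (u./2) (v./2) hu hv ih => j h k -> -> jh.
  by have : (j.+1 * k.*2.+1 <= h * k.*2.+1)%N; [rewrite leq_mul2r jh orbT | lia].
under eq_bigr => i _ do rewrite -(sum_leq_multiples (prime_gt0 p_pr) (half_bound p q i p2 q2 (ltn_ord i))).
under [X in (_ + X)%N]eq_bigr => i _
  do rewrite -(sum_leq_multiples (prime_gt0 q_pr) (half_bound q p i q2 p2 (ltn_ord i))).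
rewrite [X in (_ + X)%N]exchange_big -big_split /=.
under eq_bigr => i _.
  rewrite -big_split /=.
  under eq_bigr => j _.
    have -> : ((p * j.+1 <= q * i.+1) + (q * i.+1 <= p * j.+1) = 1)%N.
      case: ltngtP => // E; have : (p %| q * i.+1)%N by rewrite -E dvdn_mulr.
      rewrite Euclid_dvdM // (negPf npq) /= => /dvdn_leq /= /(_ isT).
      by move: (ltn_ord i) p2; lia.
    over.
  rewrite sum1_card card_ord; over.
by rewrite sum_nat_const card_ord.
Qed.

(** [chi4] and [chi8] are the Kronecker symbols of discriminants -4 and 8. *)
Definition chi4 (n : nat) : int := if (n %% 4 == 1)%N then 1 else if (n %% 4 == 3)%N then -1 else 0.
Definition chi8 (n : nat) : int :=
  if (n %% 8 \in [:: 1; 7])%N then 1 else if (n %% 8 \in [:: 3; 5])%N then -1 else 0.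

Lemma legendreN1 (p : nat) : prime p -> odd p -> legendre p (-1) = chi4 p.
Proof.
move=> p_pr p_odd; apply: (sign_inj p_pr p_odd); first exact: legendre_val.
  by rewrite /chi4; do 2![case: ifP => //].
rewrite legendre_Fp // rmorphN1 -signr_odd.
rewrite /chi4; have : (p %% 4 = 1 \/ p %% 4 = 3)%N by lia.
by case=> h; rewrite h /= ?mulrN1z;
  [have -> : odd p./2 = false by lia | have -> : odd p./2 by lia].
Qed.

Lemma count_geq (k l : nat) : (\sum_(i < k + l) (k <= i) = l)%N.
Proof.
rewrite big_split_ord /= big1 ?add0n => [|i _]; last by rewrite leqNgt ltn_ord.
by rewrite (eq_bigr (fun=> 1%N)) ?sum1_card ?card_ord // => i _; rewrite leq_addr.
Qed.

Lemma legendre2 (p : nat) : prime p -> odd p -> legendre p 2 = chi8 p.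
Proof.
move=> p_pr p_odd.
have p2 : p = p./2.*2.+1 by rewrite -[LHS]odd_double_half p_odd.
have p3 : ~~ (p %| 2)%N.
  by rewrite dvdn_prime2 //; apply: contraTneq p_odd => ->.
rewrite (gauss_lemma p_pr p_odd p3).
(* [2 * i.+1] is already below [p], and it exceeds [p./2] exactly from [i = p./2./2] on. *)
have -> : (\sum_(i < p./2) (p./2 < (2 * i.+1) %% p) = p./2 - p./2./2)%N.
  rewrite (eq_bigr (fun i : 'I_(p./2) => (p./2./2 <= i)%N : nat)); last first.
    move=> i _; rewrite modn_small; last by move: (ltn_ord i) p2; lia.
    by congr nat_of_bool; lia.
  have hk : (p./2./2 <= p./2)%N by lia.
  by rewrite -[RHS](count_geq p./2./2) subnKC.
rewrite -signr_odd /chi8 !inE.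
have : (p %% 8 = 1 \/ p %% 8 = 3 \/ p %% 8 = 5 \/ p %% 8 = 7)%N by lia.
by case=> [h|[h|[h|h]]]; rewrite h /=;
  [have -> : odd (p./2 - p./2./2) = false by lia | have -> : odd (p./2 - p./2./2) by lia
  | have -> : odd (p./2 - p./2./2) by lia | have -> : odd (p./2 - p./2./2) = false by lia].
Qed.

(** * Character sums *)

Section CharacterSums.
Variables (N : nat) (N0 : (0 < N)%N).

Definition nonprincipal (g : nat -> int) : Prop :=
  [/\ forall x y, g (x * y)%N = g x * g y, forall x, g (x %% N)%N = g x,
      forall x, `|g x| <= 1 & exists2 a, coprime a N & g a = -1].

(** Multiplication by [a] permutes the residues and negates the sum. *)
Lemma nonprincipal_sum0 (g : nat -> int) : nonprincipal g -> \sum_(m < N) g m = 0.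
Proof.
case=> gM gmod _ [a aN ga].
have ltmod (i : 'I_N) : ((a * i) %% N < N)%N by rewrite ltn_mod.
have inj : injective (fun i => Ordinal (ltmod i)).
  have W (i j : 'I_N) : (i <= j)%N -> ((a * i) %% N = (a * j) %% N)%N -> i = j.
    move=> ij /eqP; rewrite eq_sym eqn_mod_dvd ?leq_mul2l ?ij ?orbT // -mulnBr.
    rewrite Gauss_dvdr 1?coprime_sym // => d; apply/val_inj/eqP => /=.
    rewrite eqn_leq ij -subn_eq0 /=; move: d (ltn_ord j) (leq_subr i j).
    by case: (j - i)%N => // k /dvdn_leq /= /(_ isT); lia.
  by move=> i j [] e; case/orP: (leq_total i j) => ij; [apply: W | apply/esym/W].
have E : \sum_(m < N) g m = - \sum_(m < N) g m.
  rewrite {1}(reindex_inj inj) /= -sumrN; apply: eq_bigr => i _.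
  by rewrite gmod gM ga mulN1r.
by move/eqP: E; rewrite -subr_eq0 opprK -mulr2n mulrn_eq0 /= => /eqP.
Qed.

(** Full periods cancel, leaving fewer than [N] terms of absolute value at most 1. *)
Lemma nonprincipal_sum_bound (g : nat -> int) (M : nat) : nonprincipal g ->
  `|\sum_(1 <= m < M.+1) g m| <= N%:Z.
Proof.
move=> ng; have s0 := nonprincipal_sum0 ng; case: ng => gM gmod gle _.
have [k] := ubnP M; elim: k M => // k IH M Mk.
have [MN|NM] := ltnP M N.
  apply: le_trans (ler_norm_sum _ _ _) _.
  apply: le_trans (_ : \sum_(1 <= m < M.+1) (1 : int) <= _); first exact: ler_sum.
  by rewrite sumr_const_nat subn1 /= natz lez_nat ltnW.
have -> : \sum_(1 <= m < M.+1) g m = \sum_(1 <= m < (M - N).+1) g m; last by apply: IH; lia.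
have gN i : g (i + N)%N = g i by rewrite -gmod modnDr gmod.
rewrite (@big_cat_nat _ _ _ N.+1) //= [X in X + _](_ : _ = 0) ?add0r.
  by rewrite -[N.+1]/(1 + N)%N big_addn subSn //; apply: eq_bigr => i _.
rewrite -[RHS]s0 -(big_mkord xpredT) big_add1 /=.
have := gN 0%N; rewrite add0n; case: (N) N0 => // n _ gn.
by rewrite big_nat_recr //= gn big_nat_recl //= addrC.
Qed.

(** For each [a <= Y] the sum over [b] is at most [N]. If [a > Y] then [b <= Y], and the sum over
    [a] is a difference of two such sums, at most [2 N]. *)
Lemma hyperbola_bound (g h : nat -> int) (Y : nat) : nonprincipal g -> nonprincipal h ->
  `|\sum_(1 <= a < (Y ^ 2).+1) \sum_(1 <= b < (Y ^ 2).+1 | (a * b <= Y ^ 2)%N) g a * h b|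
    <= (3 * N * Y)%:Z.
Proof.
move=> ng nh; set X := (Y ^ 2)%N.
have YX : (Y <= X)%N by rewrite /X; case: (Y) => // y; rewrite expnS leq_pmulr ?expn_gt0.
have cut (k : nat -> int) (c : nat) : (0 < c)%N ->
    \sum_(1 <= b < X.+1 | (c * b <= X)%N) k b = \sum_(1 <= b < (X %/ c).+1) k b.
  move=> c0; rewrite [RHS](@big_nat_widen _ _ _ _ _ X.+1) ?ltnS ?leq_div //=.
  by apply: eq_bigl => b; rewrite ltnS leq_divRL // mulnC.
have bnd (k : nat -> int) (F : nat -> int) (c : nat) : (forall a, `|k a| <= 1) ->
    (forall a, (0 < a <= Y)%N -> `|F a| <= c%:Z) ->
    `|\sum_(1 <= a < Y.+1) k a * F a| <= (c * Y)%:Z.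
  move=> hk hF; apply: le_trans (ler_norm_sum _ _ _) _.
  apply: le_trans (_ : \sum_(1 <= m < Y.+1) c%:Z <= _); last first.
    by rewrite sumr_const_nat subn1 /= -mulr_natr natz PoszM.
  rewrite big_nat_cond [leRHS]big_nat_cond; apply: ler_sum => a.
  rewrite andbT ltnS => ha; rewrite normrM.
  by rewrite -[leRHS]mul1r; apply: ler_pM => //; exact: hF.
rewrite (@big_cat_nat _ _ _ Y.+1) //=.
apply: le_trans (ler_normD _ _) _.
have -> : (3 * N * Y)%:Z = (N * Y)%:Z + (2 * N * Y)%:Z by lia.
apply: lerD.
  rewrite (eq_big_nat _ _ (F2 := fun a => g a * \sum_(1 <= b < (X %/ a).+1) h b)); last first.
    by move=> a /andP[a1 _]; rewrite -cut // mulr_sumr.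
  by apply: bnd => [|a _]; [case: ng | exact: nonprincipal_sum_bound].
rewrite (exchange_big_dep_nat xpredT) //=.
rewrite (@big_cat_nat _ _ _ Y.+1) //= [X in _ + X]big_nat_cond [X in _ + X]big1 ?addr0; last first.
  move=> b; rewrite andbT => /andP[Yb bX]; rewrite big_nat_cond big1 // => a /andP[/andP[Ya _] ab].
  have : (Y.+1 * Y.+1 <= a * b)%N by exact: leq_mul.
  by move: ab; rewrite /X; lia.
rewrite (eq_big_nat _ _ (F2 := fun b => h b *
    (\sum_(1 <= a < (X %/ b).+1) g a - \sum_(1 <= a < Y.+1) g a))); last first.
  move=> b /andP[b1 bY]; rewrite -cut //.
  rewrite [X in _ * (X - _)](@big_cat_nat _ _ _ Y.+1) //=.
  rewrite [X in X + _ - _](_ : _ = \sum_(1 <= a < Y.+1) g a); last first.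
    rewrite big_nat_cond [RHS]big_nat_cond; apply: eq_bigl => a.
    rewrite andbT; case E: (1 <= a < Y.+1)%N => //=; case/andP: E => a1 aY.
    have : (b * a <= Y * Y)%N by exact: leq_mul.
    by rewrite /X; lia.
  rewrite addrAC subrr add0r mulr_sumr; apply: eq_big => a; first by rewrite mulnC.
  by rewrite mulrC.
apply: bnd => [|b _]; first by case: nh.
apply: le_trans (ler_normB _ _) _.
have -> : (2 * N)%:Z = N%:Z + N%:Z by lia.
by apply: lerD; exact: nonprincipal_sum_bound.
Qed.

End CharacterSums.

(** * Divisor sums of a real character *)

Section DivisorSum.
Variable chi : nat -> int.
Hypotheses (chiM : forall x y, chi (x * y)%N = chi x * chi y) (chi1 : chi 1%N = 1)
  (chi_val : forall x, chi x \in [:: 0; 1; -1]).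

Definition divisor_sum (m : nat) : int := \sum_(d <- divisors m) chi d.

(** The primes with [chi p = -1] are the inert ones when [chi] comes from a quadratic field; norms
    have even valuation there. *)
Definition inert_even (m : nat) : Prop :=
  forall p, prime p -> chi p = -1 -> ~~ odd (logn p m).

Lemma chiX (x e : nat) : chi (x ^ e)%N = chi x ^+ e.
Proof. by elim: e => [|e IH]; rewrite ?expn0 ?chi1 // expnS chiM IH exprS. Qed.

Lemma divisors_pfactor (p e m : nat) : prime p -> (0 < m)%N -> ~~ (p %| m)%N ->
  perm_eq (divisors (p ^ e * m)) [seq (p ^ i * d)%N | i <- iota 0 e.+1, d <- divisors m].
Proof.
move=> p_pr m0 pm.
have pe0 k : (0 < p ^ k)%N by rewrite expn_gt0 prime_gt0.
have npd d : d \in divisors m -> ~~ (p %| d)%N.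
  by rewrite -dvdn_divisors // => dm; apply: contra pm => /dvdn_trans; apply.
have logd i d : d \in divisors m -> logn p (p ^ i * d)%N = i.
  move=> dm; rewrite lognM ?pfactorK //; last by move: dm; rewrite -dvdn_divisors // => /dvdn_gt0; apply.
  by rewrite lognE (negPf (npd _ dm)) andbF andbF addn0.
apply: uniq_perm; first exact: divisors_uniq.
  apply: allpairs_uniq; [exact: iota_uniq | exact: divisors_uniq |].
  move=> [i d] [j c] /allpairsPdep[i' [d' [_ d'm [-> ->]]]] /allpairsPdep[j' [c' [_ c'm [-> ->]]]] /= E.
  have ij : i' = j' by rewrite -(logd i' _ d'm) E logd.
  by move: E; rewrite ij => /eqP; rewrite eqn_pmul2l // => /eqP ->.
move=> d; rewrite -dvdn_divisors ?muln_gt0 ?pe0 //; apply/idP/allpairsPdep.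
  move=> dm; have d0 : (0 < d)%N by apply: dvdn_gt0 dm; rewrite muln_gt0 pe0.
  exists (logn p d), (d`_p^')%N; split.
  - rewrite mem_iota add0n leq0n ltnS /=; have := @dvdn_leq_log p d (p ^ e * m).
    rewrite lognM // pfactorK // [logn p m]lognE (negPf pm) !andbF addn0; apply=> //.
    by rewrite muln_gt0 pe0.
  - rewrite -dvdn_divisors //; have := partn_dvd p^' _ dm; rewrite muln_gt0 pe0 m0 => /(_ isT).
    rewrite partnM // [((p ^ e)`_p^')%N]part_p'nat ?mul1n => [/dvdn_trans|]; first by apply; exact: dvdn_part.
    by rewrite pnatNK pnatX pnat_id.
  - by rewrite -p_part partnC.
case=> i [c []]; rewrite mem_iota add0n ltnS => /andP[_ ie].
by rewrite -dvdn_divisors // => cm ->; apply: dvdn_mul => //; apply: dvdn_exp2l.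
Qed.

Lemma divisor_sum_pfactor (p e m : nat) : prime p -> (0 < m)%N -> ~~ (p %| m)%N ->
  divisor_sum (p ^ e * m) = (\sum_(i < e.+1) chi p ^+ i) * divisor_sum m.
Proof.
move=> p_pr m0 pm; rewrite /divisor_sum (perm_big _ (divisors_pfactor e p_pr m0 pm)).
rewrite big_allpairs_dep -(big_mkord xpredT (fun i => chi p ^+ i)) /index_iota subn0 mulr_suml; apply: eq_bigr => i _.
by rewrite mulr_sumr; apply: eq_bigr => d _; rewrite chiM chiX.
Qed.

(** For [c] equal to 0, 1, -1 the sum is 1, [e + 1], and the indicator of even [e]. *)
Lemma geometric_sign_sum (c : int) (e : nat) : c \in [:: 0; 1; -1] ->
  0 <= \sum_(i < e.+1) c ^+ i /\
  (0 < \sum_(i < e.+1) c ^+ i <-> (c = -1 -> ~~ odd e)).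
Proof.
rewrite !inE => /or3P[]/eqP->.
- rewrite big_ord_recl expr0 big1 ?addr0 => [|i _]; last by rewrite expr0n.
  by split => //; split.
- under eq_bigr do rewrite expr1n.
  by rewrite sumr_const card_ord natz; split => //; split.
- have -> : \sum_(i < e.+1) (-1) ^+ i = (~~ odd e)%:Z :> int.
    elim: e => [|e IH]; first by rewrite big_ord1 expr0.
    by rewrite big_ord_recr IH /= -signr_odd /=; case: odd.
  by case: odd; split => //; split => // /(_ erefl).
Qed.

(** [divisor_sum] is a product of geometric sums over the prime powers in [m]; the induction strips
    the least prime. *)
Lemma divisor_sum_sign (m : nat) : (0 < m)%N ->
  0 <= divisor_sum m /\ (0 < divisor_sum m <-> inert_even m).
Proof.
have [k] := ubnP m; elim: k m => // k IH m mk m0.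
have [m1|m1] := leqP m 1.
  have -> : m = 1%N by lia.
  rewrite /divisor_sum big_seq1 chi1; split=> //; split=> // _ p _ _.
  by rewrite logn1.
pose p := pdiv m; have p_pr : prime p := pdiv_prime m1.
pose e := logn p m; pose m' := (m %/ p ^ e)%N.
have pem : (p ^ e %| m)%N := pfactor_dvdnn p m.
have mE : m = (p ^ e * m')%N by rewrite mulnC divnK.
have m'0 : (0 < m')%N by move: m0; rewrite {1}mE muln_gt0 => /andP[].
have e0 : (0 < e)%N by rewrite logn_gt0 mem_primes p_pr m0 pdiv_dvd.
have logm : logn p m' = 0%N by rewrite logn_div // pfactorK // subnn.
have pm' : ~~ (p %| m')%N by move/eqP: logm; rewrite lognE p_pr m'0 /=; case: ifP.
have m'm : (m' < m)%N.
  rewrite mE -{1}(mul1n m') ltn_pmul2r //.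
  by apply: leq_trans (_ : p <= _)%N; [exact: prime_gt1 | rewrite -{1}(expn1 p) leq_exp2l ?prime_gt1].
clearbody m'.
have [r0 rP] := IH m' (leq_trans m'm (ltnSE mk)) m'0.
have [g0 gP] := geometric_sign_sum e (chi_val p).
rewrite {1 2}mE divisor_sum_pfactor //; split; first exact: mulr_ge0.
have logE q : prime q -> logn q m = ((p == q) * e + logn q m')%N.
  have pe0 : (0 < p ^ e)%N by rewrite expn_gt0 prime_gt0.
  move=> q_pr; have -> : logn q m = (logn q (p ^ e) + logn q m')%N by rewrite -lognM // -mE.
  by rewrite lognX (logn_prime q p_pr) mulnC eq_sym.
split.
  move=> h q q_pr cq.
  have gn0 : 0 < \sum_(i < e.+1) chi p ^+ i.
    by rewrite lt_def g0 andbT; apply: contraTneq h => ->; rewrite mul0r.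
  have rn0 : 0 < divisor_sum m' by rewrite pmulr_rgt0 in h.
  rewrite logE // oddD.
  have := (rP.1 rn0) q q_pr cq => /negPf ->.
  rewrite addbF; case: eqP => [pq|_]; rewrite ?mul1n ?mul0n //.
  by apply: (gP.1 gn0); rewrite pq.
move=> h; apply: mulr_gt0; first by apply/gP => cp; exact: h.
apply/rP => q q_pr cq; have := h q q_pr cq; rewrite logE //.
by case: eqP => [<-|_]; rewrite ?mul0n // logm.
Qed.

End DivisorSum.

Definition pair_sum (X : nat) (F : nat -> nat -> int) : int :=
  \sum_(1 <= a < X.+1) \sum_(1 <= b < X.+1 | (a * b <= X)%N) F a b.

Lemma pair_sum_swap (X : nat) (F : nat -> nat -> int) :
  pair_sum X (fun a b => F b a) = pair_sum X F.
Proof.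
rewrite /pair_sum (exchange_big_dep_nat xpredT) //=.
by apply: eq_bigr => a _; apply: eq_bigl => b; rewrite mulnC.
Qed.

Lemma sum_multiples (X d : nat) (F : nat -> int) : (0 < d)%N ->
  \sum_(1 <= m < X.+1 | (d %| m)%N) F m = \sum_(1 <= a < X.+1 | (a * d <= X)%N) F (a * d)%N.
Proof.
move=> d0; rewrite -!(big_filter (index_iota 1 X.+1)).
rewrite -(big_map (muln^~ d) xpredT F); apply: perm_big; apply: uniq_perm.
- by rewrite filter_uniq ?iota_uniq.
- rewrite map_inj_uniq ?filter_uniq ?iota_uniq // => a b /eqP.
  by rewrite eqn_pmul2r // => /eqP.
move=> m; rewrite mem_filter mem_index_iota ltnS; apply/idP/mapP.
  case/andP=> /dvdnP[a ->] /andP[ad1 adX]; exists a => //.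
  rewrite mem_filter mem_index_iota ltnS adX; move: ad1; rewrite muln_gt0 => /andP[-> _] /=.
  by apply: leq_trans adX; rewrite leq_pmulr.
case=> a; rewrite mem_filter mem_index_iota => /andP[aX /andP[a1 _]] ->.
by rewrite dvdn_mull // muln_gt0 a1 d0.
Qed.

Lemma pair_sum_divisor (X : nat) (chi W : nat -> int) :
  pair_sum X (fun a b => W (a * b)%N * chi b)
    = \sum_(1 <= m < X.+1) W m * divisor_sum chi m.
Proof.
rewrite -pair_sum_swap.
transitivity (\sum_(1 <= m < X.+1) \sum_(1 <= d < X.+1 | (d %| m)%N) W m * chi d).
  rewrite /pair_sum [RHS](exchange_big_dep_nat xpredT) //=.
  rewrite big_nat_cond [RHS]big_nat_cond; apply: eq_bigr => d; rewrite andbT => /andP[d1 _].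
  have /= -> := sum_multiples X (fun m => W m * chi d) d1.
  by apply: eq_bigl => a; rewrite mulnC.
rewrite big_nat_cond [RHS]big_nat_cond; apply: eq_bigr => m; rewrite andbT => /andP[m1 mX].
rewrite -mulr_sumr; congr (_ * _); rewrite -big_filter; apply: perm_big; apply: uniq_perm.
- by rewrite filter_uniq ?iota_uniq.
- exact: divisors_uniq.
move=> d; rewrite mem_filter mem_index_iota -dvdn_divisors //.
apply/andP/idP => [[]//|dm]; split=> //; rewrite (dvdn_gt0 m1 dm) /=.
by apply: leq_ltn_trans mX; apply: dvdn_leq.
Qed.

Lemma sum_over_values (I : finType) (X : nat) (F : nat -> int) (v : I -> nat) :
  injective v -> (forall i, (0 < v i <= X)%N) -> (forall m, (0 < m)%N -> 0 <= F m) ->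
  (forall i, 1 <= F (v i)) -> #|I|%:Z <= \sum_(1 <= m < X.+1) F m.
Proof.
move=> vinj vX F0 F1; pose P := [seq v i | i <- enum I].
apply: le_trans (_ : \sum_(1 <= m < X.+1 | m \in P) F m <= _); last first.
  rewrite big_mkcond big_nat_cond [leRHS]big_nat_cond; apply: ler_sum => m.
  by rewrite andbT => /andP[m1 _]; case: ifP => // _; apply: F0.
rewrite -big_filter (perm_big P) /=; last first.
  apply: uniq_perm; [by rewrite filter_uniq ?iota_uniq | by rewrite map_inj_uniq ?enum_uniq |].
  move=> m; rewrite mem_filter andb_idr // => /mapP[i _ ->].
  by rewrite mem_index_iota ltnS.
rewrite big_map big_enum /= -[#|I|]muln1 -natz -sum_nat_const natr_sum.
by apply: ler_sum => i _; apply: F1.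
Qed.

(** * Existence of integers with prescribed local characters *)

Section Existence.
Variables (I : finType) (q : I -> nat) (f : I -> nat -> int) (eps : I -> int) (n : nat).
Hypotheses (q_gt0 : forall i, (0 < q i)%N)
  (q_coprime : forall i j, i != j -> coprime (q i) (q j))
  (fM : forall i x y, f i (x * y)%N = f i x * f i y)
  (f_mod : forall i x, f i (x %% q i)%N = f i x)
  (f_val : forall i x, f i x \in [:: 0; 1; -1])
  (f_eq0 : forall i x, (f i x == 0) = ~~ coprime x (q i))
  (f_neg : forall i, exists x, f i x = -1)
  (eps_val : forall i, eps i \in [:: 1; -1])
  (eps_prod : \prod_i eps i = 1).

Let N := (\prod_i q i)%N.
Let chi (m : nat) : int := \prod_i f i m.
(** Outside [S] the square stands for the principal character modulo [q i]: [g setT] is [chi] and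
    [g set0] is the principal character modulo [N]. *)
Let g (S : {set I}) (m : nat) : int := \prod_i (if i \in S then f i m else f i m ^+ 2).

Let N_gt0 : (0 < N)%N. Proof. by rewrite prodn_gt0. Qed.

Let q_dvd i : (q i %| N)%N. Proof. by rewrite /N (bigD1 i) //= dvdn_mulr. Qed.

Lemma coprime_mod_prod (P : pred I) (x : nat) :
  (forall i, P i -> coprime x (q i)) -> coprime x (\prod_(i | P i) q i).
Proof. by move=> h; elim/big_ind: _ => [|a b ca cb|i /h//]; rewrite ?coprimen1 ?coprimeMr ?ca. Qed.

Let f1 i : f i 1%N = 1.
Proof.
have := fM i 1 1; have := f_eq0 i 1; rewrite coprime1n /= muln1.
by have := f_val i 1%N; rewrite !inE => /or3P[]/eqP->.
Qed.

Let f_cube i x : f i x ^+ 2 * f i x = f i x.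
Proof. by have := f_val i x; rewrite !inE => /or3P[]/eqP->. Qed.

Let gM S x y : g S (x * y)%N = g S x * g S y.
Proof.
by rewrite /g -big_split; apply: eq_bigr => i _ /=; rewrite fM; case: ifP => // _; rewrite exprMn.
Qed.

Let chiE m : chi m = g setT m.
Proof. by apply: eq_bigr => i _; rewrite inE. Qed.

Let g_mod S x : g S (x %% N)%N = g S x.
Proof.
by apply: eq_bigr => i _; rewrite -(f_mod i (x %% N)) modn_dvdm // f_mod.
Qed.

Let g_val S x : g S x \in [:: 0; 1; -1].
Proof.
rewrite /g; elim/big_ind: _ => // [a b|i _].
  by rewrite !inE => /or3P[]/eqP-> /or3P[]/eqP->.
by case: ifP => // _; have := f_val i x; rewrite !inE => /or3P[]/eqP->.
Qed.

(** Chinese remainders give [a] with [f i a = -1] at one [i] in [S] and value 1 at all other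
    indices. *)
Let g_nonprincipal S : S != set0 -> nonprincipal N (g S).
Proof.
case/set0Pn=> i iS; split=> [x y|x|x|]; [exact: gM | exact: g_mod | |].
  by have := g_val S x; rewrite !inE => /or3P[]/eqP->.
have [x0 fx0] := f_neg i.
pose M := (\prod_(j | j != i) q j)%N.
have cM : coprime (q i) M by apply: coprime_mod_prod => j ji; apply: q_coprime; rewrite eq_sym.
pose a := chinese (q i) M x0 1.
have fa : f i a = -1 by rewrite -f_mod chinese_modl // f_mod.
have fa' j : j != i -> f j a = 1.
  move=> ji; rewrite -(f1 j) -(f_mod j a) -(f_mod j 1).
  have qM : (q j %| M)%N by rewrite /M (bigD1 j) //= dvdn_mulr.
  by rewrite -(modn_dvdm a qM) chinese_modr // modn_dvdm.
exists a.
  apply: coprime_mod_prod => j _; rewrite -[coprime _ _]negbK -f_eq0.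
  by have [->|/fa' ->] := eqVneq j i; rewrite ?fa.
rewrite /g (bigD1 i) //= iS fa big1 ?mulr1 // => j /fa' ->.
by case: ifP; rewrite ?expr1n.
Qed.

(** Each factor is 2 when [f i m = eps i] and 0 otherwise. *)
Let W (m : nat) : int := \prod_i (f i m ^+ 2 + eps i * f i m).

(** Since [f i] cubed is [f i], each factor is [eps i] times [f i a] times a principal character at
    [b], plus the same with [a] and [b] exchanged and no [eps i]. *)
Let W_expand a b : W (a * b)%N * chi b =
  \sum_(S : {set I}) (\prod_i (if i \in S then eps i else 1)) * (g S a * g (~: S) b).
Proof.
rewrite /W /chi -big_split /=.
under eq_bigr => i _.
  have -> : (f i (a * b)%N ^+ 2 + eps i * f i (a * b)%N) * f i b
     = eps i * (f i a * f i b ^+ 2) + f i a ^+ 2 * f i b.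
    by rewrite -[X in _ = _ + _ * X]f_cube !fM; ring.
  over.
rewrite bigA_distr; apply: eq_bigr => S _; rewrite -!big_split /=.
by apply: eq_bigr => i _; rewrite inE; case: ifP => _ /=; rewrite ?mul1r.
Qed.

Hypothesis n_gt0 : (0 < n)%N.
Hypothesis inert_dvd : forall p x y, prime p -> odd p -> chi p = -1 ->
  (p %| x ^ 2 + n * y ^ 2)%N -> (p %| x)%N && (p %| y)%N.

Let chiM x y : chi (x * y)%N = chi x * chi y. Proof. by rewrite !chiE gM. Qed.
Let chi1 : chi 1%N = 1. Proof. by rewrite /chi big1. Qed.
Let chi_val x : chi x \in [:: 0; 1; -1]. Proof. by rewrite chiE g_val. Qed.

(** Descent: an inert prime dividing the value divides [x] and [y], so its square can be removed. *)
Lemma inert_even_norm (x y : nat) : odd (x ^ 2 + n * y ^ 2) ->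
  inert_even chi (x ^ 2 + n * y ^ 2).
Proof.
move=> m_odd p p_pr cp.
case: (even_prime p_pr) => [p2|p_odd]; first by rewrite lognE p2 dvdn2 m_odd andbF.
have [k] := ubnP (x + y)%N; elim: k x y m_odd => // k IH x y m_odd hk.
have [pm|/negPf pm] := boolP (p %| x ^ 2 + n * y ^ 2)%N; last by rewrite lognE pm !andbF.
have /andP[/dvdnP[x' Ex] /dvdnP[y' Ey]] := inert_dvd p_pr p_odd cp pm.
have E : (x ^ 2 + n * y ^ 2 = p ^ 2 * (x' ^ 2 + n * y' ^ 2))%N by rewrite Ex Ey; ring.
have m'_odd : odd (x' ^ 2 + n * y' ^ 2) by move: m_odd; rewrite E oddM => /andP[].
have p1 := prime_gt1 p_pr.
have xy0 : (0 < x + y)%N by move: m_odd; case: (x) (y) => [|?] [|?] //; rewrite muln0.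
rewrite E lognM ?expn_gt0 ?(ltnW p1) ?odd_gt0 // pfactorK // oddD /=; apply: IH => //.
suff : (x' + y' < x + y)%N by move: hk; lia.
have : (0 < x' + y')%N by move: xy0; rewrite Ex Ey; case: (x') (y') => [|?] [|?].
by move=> s0; rewrite Ex Ey -mulnDl ltn_Pmulr.
Qed.

Let B (X : nat) : int := pair_sum X (fun a b => g set0 a * g setT b).

(** The subsets [set0] and [setT] both contribute [B X], the latter because the [eps i] multiply to
    1. *)
Let sum_expand (X : nat) : (0 < #|I|)%N ->
  \sum_(1 <= m < X.+1) W m * divisor_sum chi m = 2 * B X +
  \sum_(S : {set I} | (S != set0) && (S != setT)) (\prod_i (if i \in S then eps i else 1)) *
     pair_sum X (fun a b => g S a * g (~: S) b).
Proof.
move=> I0; rewrite -pair_sum_divisor.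
transitivity (\sum_(S : {set I}) (\prod_i (if i \in S then eps i else 1)) *
     pair_sum X (fun a b => g S a * g (~: S) b)).
  rewrite /pair_sum; under eq_bigr => a _.
    under eq_bigr do rewrite W_expand.
    rewrite exchange_big /=; over.
  rewrite exchange_big /=; apply: eq_bigr => S _; rewrite mulr_sumr.
  by apply: eq_bigr => a _; rewrite mulr_sumr.
rewrite (bigD1 set0) //= (bigD1 setT) /=; last first.
  by rewrite -card_gt0 cardsT.
rewrite addrA; congr (_ + _).
rewrite [\prod_i _]big1 => [|i _]; last by rewrite inE.
rewrite (eq_bigr eps) => [|i _]; last by rewrite inE.
rewrite eps_prod !mul1r setC0 setCT.
have -> : pair_sum X (fun a b => g setT a * g set0 b) = B X.
  rewrite /B -pair_sum_swap; apply: eq_bigr => a _; apply: eq_bigr => b _.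
  exact: mulrC.
by rewrite /B; ring.
Qed.

Let B_divisor (X : nat) : B X = \sum_(1 <= m < X.+1) g set0 m * divisor_sum chi m.
Proof.
rewrite -pair_sum_divisor; apply: eq_bigr => a _; apply: eq_bigr => b _.
rewrite gM -mulrA; congr (_ * _); rewrite -chiE /chi -big_split /=.
by apply: eq_bigr => i _; rewrite inE f_cube.
Qed.

Let rest_bound (Y : nat) :
  `|\sum_(S : {set I} | (S != set0) && (S != setT)) (\prod_i (if i \in S then eps i else 1)) *
     pair_sum (Y ^ 2) (fun a b => g S a * g (~: S) b)| <= (2 ^ #|I| * (3 * N * Y))%:Z.
Proof.
apply: le_trans (ler_norm_sum _ _ _) _.
apply: le_trans (_ : \sum_(S : {set I}) (3 * N * Y)%:Z <= _); last first.
  by rewrite sumr_const -[#|_|]cardsT -powersetT card_powerset cardsT -mulr_natl natz PoszM.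
rewrite big_mkcond; apply: ler_sum => S _; case: ifP => // /andP[S0 ST].
have SC : ~: S != set0 by apply: contraNneq ST => h; rewrite -(setCK S) h setC0.
have e1 : `|\prod_i (if i \in S then eps i else 1)| <= 1.
  rewrite normr_prod; apply: prodr_ile1 => i; rewrite normr_ge0 /=.
  by case: ifP => // _; have := eps_val i; rewrite !inE => /orP[]/eqP->.
rewrite normrM -[leRHS]mul1r; apply: ler_pM; rewrite ?normr_ge0 //.
by have := hyperbola_bound N_gt0 Y (g_nonprincipal S0) (g_nonprincipal SC); rewrite /pair_sum.
Qed.

Let g0_sqr S x : g set0 x = g S x ^+ 2.
Proof.
rewrite /g -prodrXl; apply: eq_bigr => i _; rewrite inE; case: ifP => // _.
by have := f_val i x; rewrite !inE => /or3P[]/eqP->.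
Qed.

(** With [x = 1] and [y = 0] modulo [2 N], the values [x ^ 2 + n y ^ 2] are odd and prime to [N], so
    each contributes at least 1; [K * L] distinct ones are exhibited. *)
Let B_lower (X K L A : nat) : (0 < A)%N -> (n * (2 * N * K) ^ 2 <= A)%N ->
  ((1 + 2 * N * (A + L)) ^ 2 + A <= X)%N -> (K * L)%:Z <= B X.
Proof.
move=> A0 hA hX; rewrite B_divisor.
pose x (p : 'I_K * 'I_L) := (1 + 2 * N * (A + p.2))%N.
pose y (p : 'I_K * 'I_L) := (2 * N * p.1.+1)%N.
pose v p := (x p ^ 2 + n * y p ^ 2)%N.
have N1 : (0 < 2 * N)%N by rewrite muln_gt0.
have yA p : (n * y p ^ 2 <= A)%N.
  by apply: leq_trans hA; rewrite leq_mul2l leq_exp2r // leq_mul2l ltn_ord !orbT.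
have xA p : (A < x p)%N.
  by rewrite /x add1n ltnS; apply: leq_trans (leq_addr p.2 A) _; rewrite leq_pmull.
have xL p : (x p <= 1 + 2 * N * (A + L))%N.
  by rewrite leq_add2l leq_mul2l leq_add2l (ltnW (ltn_ord _)) orbT.
have v_odd p : odd (v p).
  have -> : v p = (2 * (N * ((A + p.2) * (2 + 2 * N * (A + p.2))
     + n * 2 * p.1.+1 ^ 2 * N))).+1 by rewrite -add1n /v /x /y; ring.
  by rewrite /= oddM.
have vinj : injective v.
  (* [n y ^ 2 <= A < x], so increasing [x] changes [x ^ 2] by more than any change of [n y ^ 2]. *)
  have lt_neq p p' : (x p < x p')%N -> v p <> v p'.
    move=> lt_x; have := yA p; have := xA p; rewrite /v.
    have : (x p ^ 2 + 2 * x p < x p' ^ 2)%N.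
      apply: leq_trans (_ : (x p).+1 ^ 2 <= _)%N; last by rewrite leq_exp2r.
      by clear; move: (x p) => u; lia.
    by move: (n * _)%N (n * _)%N (x p ^ 2)%N (x p' ^ 2)%N (x p); clear; lia.
  move=> p p' e; have [lt_x|lt_x|ex] := ltngtP (x p) (x p').
  - by case: (lt_neq _ _ lt_x).
  - by case: (lt_neq _ _ lt_x).
  have ey : y p = y p'.
    move: e; rewrite /v ex => /eqP; rewrite eqn_add2l eqn_pmul2l // eqn_exp2r //.
    by move/eqP.
  move: ex ey; rewrite /x /y => /eqP; rewrite eqn_add2l eqn_pmul2l // eqn_add2l => /eqP e2.
  move=> /eqP; rewrite eqn_pmul2l // eqSS => /eqP e1.
  by case: p p' {e} e1 e2 => [p1 p2] [p1' p2'] /= /val_inj -> /val_inj ->.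
have -> : (K * L)%N = #|{: 'I_K * 'I_L}| by rewrite card_prod !card_ord.
have D m : (0 < m)%N -> 0 <= divisor_sum chi m /\ (0 < divisor_sum chi m <-> inert_even chi m).
  exact: divisor_sum_sign.
apply: (sum_over_values vinj) => [p|m m0|p].
- rewrite (odd_gt0 (v_odd p)) /=; apply: leq_trans hX; apply: leq_add => //.
  by rewrite leq_exp2r.
- by apply: mulr_ge0; [rewrite (g0_sqr set0) sqr_ge0 | case: (D m m0)].
have vN : (v p %% N = 1 %% N)%N.
  have -> : v p = (1 + N * (2 * (A + p.2) * (2 + 2 * N * (A + p.2))
     + n * (2 * p.1.+1) ^ 2 * N))%N by rewrite /v /x /y; ring.
  by rewrite mulnC addnC modnMDl.
have -> : g set0 (v p) = 1.
  by rewrite -g_mod vN g_mod /g big1 // => i _; rewrite inE f1.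
by rewrite mul1r -gtz0_ge1; apply/(D _ (odd_gt0 (v_odd p))).2/inert_even_norm/v_odd.
Qed.

Lemma exists_prescribed_characters : (0 < #|I|)%N ->
  exists m, [/\ (0 < m)%N, forall i, f i m = eps i & inert_even chi m].
Proof.
move=> I0.
(* [C * Y] is the bound of [rest_bound]. As [Y <= (4 N + 2) A] below, this [K] makes [K * A] exceed
   it. *)
pose C := (2 ^ #|I| * (3 * N))%N; pose K := (C * (2 * (2 * N) + 2)).+1.
have [A A0 hA] : exists2 A, (0 < A)%N & (n * (2 * N * K) ^ 2 <= A)%N.
  by exists (n * (2 * N * K) ^ 2)%N; rewrite // muln_gt0 n_gt0 expn_gt0 !muln_gt0 N_gt0.
pose Y := (1 + 2 * N * (A + A) + A)%N; pose X := (Y ^ 2)%N.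
have hB : (K * A)%:Z <= B X.
  apply: (B_lower A0 hA); rewrite /X /Y.
  rewrite [leqRHS]sqrnD -[leqRHS]addnA leq_add2l.
  have AA : (A <= A * A)%N by exact: leq_pmulr.
  exact: leq_trans AA (leq_addr _ _).
have Y_le : (Y <= (2 * (2 * N) + 2) * A)%N.
  have -> : ((2 * (2 * N) + 2) * A = 2 * N * (A + A) + A + A)%N by ring.
  by rewrite /Y -addnA addnC leq_add2l.
have [/hasP[m]|no] := boolP (has (fun m => W m * divisor_sum chi m != 0) (index_iota 1 X.+1)).
  rewrite mem_index_iota => /andP[m0 _]; rewrite mulf_eq0 negb_or => /andP[Wm Dm].
  have [D0 DP] := divisor_sum_sign chiM chi1 chi_val m0.
  exists m; split=> // [i|]; last by apply/DP; rewrite lt_def Dm.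
  move/prodf_neq0: Wm => /(_ i isT).
  have := f_val i m; have := eps_val i.
  by rewrite !inE => /orP[]/eqP-> /or3P[]/eqP->.
have S0 : \sum_(1 <= m < X.+1) W m * divisor_sum chi m = 0.
  rewrite big_seq_cond big1 // => m; rewrite andbT => mX; apply/eqP; apply: contraNT no => h.
  by apply/hasP; exists m.
(* If all weights vanished, then [2 B <= C Y < B], which is absurd for positive [B]. *)
have := rest_bound Y; have := sum_expand X I0; rewrite S0 -/X.
move: (\sum_(S | _) _) => R hR hRb.
have : (C * Y)%:Z < B X.
  apply: lt_le_trans hB; rewrite ltz_nat /K mulSn.
  apply: leq_ltn_trans (_ : C * ((2 * (2 * N) + 2) * A) < _)%N; first by rewrite leq_mul2l Y_le orbT.
  by rewrite mulnA -[ltnLHS]add0n ltn_add2r.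
have -> : (C * Y = 2 ^ #|I| * (3 * N * Y))%N by rewrite /C !mulnA.
by move: hR hRb; clear; lia.
Qed.

End Existence.

(** * The three squares theorem *)

Definition sqfree (m : nat) : Prop := forall p, prime p -> ~~ (p ^ 2 %| m)%N.

Lemma sqfree_decomposition (m : nat) : (0 < m)%N ->
  exists k s : nat, [/\ (0 < k)%N, (0 < s)%N, sqfree s & m = (k ^ 2 * s)%N].
Proof.
have [l] := ubnP m; elim: l m => // l IH m ml m0.
have [/hasP[p] | no] := boolP (has (fun p => p ^ 2 %| m)%N (primes m)).
  rewrite mem_primes => /and3P[p_pr _ _] /dvdnP[m1 Em].
  have p1 := prime_gt1 p_pr.
  have m10 : (0 < m1)%N by move: m0; rewrite Em muln_gt0 => /andP[].
  have m1m : (m1 < m)%N by rewrite Em ltn_Pmulr // -(exp1n 2) ltn_exp2r.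
  have [k [s [k0 s0 sq Em1]]] := IH m1 (leq_trans m1m (ltnSE ml)) m10.
  exists (p * k)%N, s; split=> //; first by rewrite muln_gt0 (ltnW p1).
  by rewrite Em Em1; ring.
exists 1%N, m; split=> // [p p_pr|]; last by rewrite exp1n mul1n.
apply: contra no => pm; apply/hasP; exists p => //.
by rewrite mem_primes p_pr m0 (dvdn_trans _ pm) // dvdn_mulr.
Qed.

Lemma sqfree_dvd (d m : nat) : (d %| m)%N -> sqfree m -> sqfree d.
Proof. by move=> dm sq p /sq; apply: contra => /dvdn_trans; apply. Qed.

Lemma sqfree_logn (p m : nat) : prime p -> (0 < m)%N -> sqfree m -> (p %| m)%N -> logn p m = 1%N.
Proof.
move=> p_pr m0 sq pm; apply/eqP; rewrite eqn_leq logn_gt0 mem_primes p_pr m0 pm andbT.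
by rewrite leqNgt -pfactor_dvdn // sq.
Qed.

Lemma prod_primes_sqfree (m : nat) : (0 < m)%N -> sqfree m -> (\prod_(p <- primes m) p = m)%N.
Proof.
move=> m0 sq; rewrite {2}(prod_prime_decomp m0) /primes big_map big_seq [RHS]big_seq.
apply: eq_bigr => -[p e] /= pe.
have /mem_prime_decomp[p_pr e0 pem] := pe.
have : (e < 2)%N by rewrite ltnNge; apply: contra (sq p p_pr) => /(dvdn_exp2l p) /dvdn_trans; apply.
by case: e e0 {pe pem} => [|[|]] // _ _; rewrite expn1.
Qed.

(** Local roots are glued one prime at a time, each prime being coprime to its cofactor. *)
Lemma sqfree_crt (c : int) (m : nat) : (0 < m)%N -> sqfree m ->
  (forall p, prime p -> (p %| m)%N -> exists t : int, (p %| t ^+ 2 + c)%Z) ->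
  exists t : int, (m %| t ^+ 2 + c)%Z.
Proof.
have [l] := ubnP m; elim: l m => // l IH m ml m0 sq loc.
have [m1|m1] := leqP m 1; first by exists 0; have -> : m = 1%N by [lia]; rewrite dvd1z.
pose p := pdiv m; have p_pr : prime p := pdiv_prime m1.
have pm : (p %| m)%N := pdiv_dvd m.
have [m' Em] := dvdnP pm.
have m'0 : (0 < m')%N by move: m0; rewrite Em muln_gt0 => /andP[].
have m'm : (m' < m)%N by rewrite Em ltn_Pmulr ?prime_gt1.
have dm' : (m' %| m)%N by rewrite Em dvdn_mulr.
have [t2 h2] : exists t : int, (m' %| t ^+ 2 + c)%Z.
  apply: IH; [exact: leq_trans m'm (ltnSE ml) | exact: m'0 | exact: sqfree_dvd dm' sq |].
  by move=> r r_pr rm'; apply: loc => //; apply: dvdn_trans dm'.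
have [t1 h1] := loc p p_pr pm.
have cop : coprimez m' p.
  rewrite coprimezE coprime_sym /= prime_coprime //.
  apply: contra (sq p p_pr) => pm'; rewrite Em mulnC -mulnn.
  by rewrite dvdn_pmul2l ?prime_gt0.
have /coprimezP[[al be] /= bez] := cop.
pose T := t2 + al * m' * (t1 - t2).
exists T; rewrite Em PoszM Gauss_dvdz //.
have shift (d : int) (t : int) : (d %| T - t)%Z -> (d %| t ^+ 2 + c)%Z -> (d %| T ^+ 2 + c)%Z.
  move=> dT dt; have -> : T ^+ 2 + c = (T - t) * (T + t) + (t ^+ 2 + c) by ring.
  by apply: rpredD => //; apply: dvdz_mulr.
apply/andP; split.
  apply: shift h2; have -> : T - t2 = m'%:Z * (al * (t1 - t2)) by rewrite /T; ring.
  exact: dvdz_mulr.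
apply: shift h1; have -> : T - t1 = p%:Z * (be * (t2 - t1)).
  have -> : T - t1 = (t2 - t1) * (1 - al * m') by rewrite /T; ring.
  have -> : 1 - al * m' = be * p by apply/eqP; rewrite subr_eq addrC bez.
  by ring.
exact: dvdz_mulr.
Qed.

(** Bundles what the existence argument asks of each local character. *)
Record quadratic_character (q : nat) (f : nat -> int) : Prop := QuadraticCharacter {
  qchar_mod_gt0 : (0 < q)%N;
  qcharM : forall x y, f (x * y)%N = f x * f y;
  qchar_mod : forall x, f (x %% q)%N = f x;
  qchar_val : forall x, f x \in [:: 0; 1; -1];
  qchar_eq0 : forall x, (f x == 0) = ~~ coprime x q;
  qchar_neg : exists x, f x = -1 }.

Lemma legendre_quadratic_character (p : nat) : prime p -> odd p ->
  quadratic_character p (fun m => legendre p m).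
Proof.
move=> p_pr p_odd; split.
- exact: prime_gt0.
- by move=> x y; rewrite PoszM legendreM.
- move=> x; apply: legendre_mod => //; apply/dvdzP; exists (- Posz (x %/ p)).
  by rewrite {2}(divn_eq x p) PoszD PoszM; ring.
- by move=> x; apply: legendre_val.
- by move=> x; rewrite legendre_eq0 // coprime_sym prime_coprime // negbK.
(* A generator is a non-residue: its order [p - 1] does not divide [p./2]. *)
have /cyclicP[g Eg] := field_unit_group_cyclic [set: {unit 'F_p}]%G.
have og : #[g]%g = p.-1 by rewrite /order -Eg card_finField_unit card_Fp.
exists (val (val g) : nat).
have vg : (Posz (val (val g)))%:~R = val g :> 'F_p by rewrite -pmulrn natr_Zp.
rewrite /legendre vg; have := valP g; rewrite unitfE => /negPf ->.
case: ifP => // /eqP h.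
have /eqP : (g ^+ p./2)%g = 1%g by apply/val_inj; rewrite FinRing.val_unitX.
rewrite -order_dvdn og => /dvdn_leq.
by have := prime_gt1 p_pr; move: p_odd; clear; move=> h1 h2 h3; exfalso; move: h3; lia.
Qed.

Lemma residue_quadratic_character (q : nat) (f : nat -> int) : (0 < q)%N ->
  (forall x, f (x %% q)%N = f x) ->
  all (fun x => all (fun y => f (x * y)%N == f x * f y) (iota 0 q)) (iota 0 q) ->
  all (fun x => (f x \in [:: 0; 1; -1]) && ((f x == 0) == ~~ coprime x q)) (iota 0 q) ->
  has (fun x => f x == -1) (iota 0 q) -> quadratic_character q f.
Proof.
move=> q0 f_mod fM /allP fv fneg.
have inq x : (x %% q)%N \in iota 0 q by rewrite mem_iota ltn_mod.
split=> // [x y|x|x|].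
- rewrite -f_mod -modnMm f_mod -(f_mod x) -(f_mod y).
  by apply/eqP; move/allP: fM => /(_ _ (inq x)) /allP; apply.
- by rewrite -f_mod; have /andP[] := fv _ (inq x).
- by rewrite -f_mod; have /andP[_ /eqP ->] := fv _ (inq x); rewrite coprime_modl.
- by case/hasP: fneg => x _ /eqP; exists x.
Qed.

Definition chim8 (m : nat) : int := chi4 m * chi8 m.

Lemma chi4_quadratic_character : quadratic_character 4 chi4.
Proof. by apply: residue_quadratic_character => // x; rewrite /chi4 modn_mod. Qed.

Lemma chi8_quadratic_character : quadratic_character 8 chi8.
Proof. by apply: residue_quadratic_character => // x; rewrite /chi8 modn_mod. Qed.

Lemma chim8_quadratic_character : quadratic_character 8 chim8.
Proof.
apply: residue_quadratic_character => // x.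
by rewrite /chim8 /chi4 /chi8 modn_mod modn_dvdm.
Qed.

(** Passing to the squarefree part [r] keeps the characters. Its primes have odd exponent in [m] and
    nonzero [chi], hence [chi p = 1]. So 2 is excluded, and [- n] is a square modulo each prime of
    [r]. *)
Lemma exists_split_residue (n : nat) (s : seq nat) (F : nat -> nat -> int) (E : nat -> int) :
  (0 < n)%N -> s != [::] -> uniq s -> {in s &, forall q r, q != r -> coprime q r} ->
  {in s, forall q, quadratic_character q (F q)} -> {in s, forall q, E q \in [:: 1; -1]} ->
  \prod_(q <- s) E q = 1 ->
  (forall p, prime p -> odd p -> \prod_(q <- s) F q p = legendre p (- n%:Z)) ->
  \prod_(q <- s) F q 2 != 1 ->
  exists m, [/\ (0 < m)%N, sqfree m, odd m, {in s, forall q, F q m = E q}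
    & exists t : int, (m %| t ^+ 2 + n)%Z].
Proof.
move=> n0 s0 us cs Fs Es prodE chiP chi2.
pose I := 'I_(size s); pose q (i : I) := nth 0%N s i.
have qs i : q i \in s by apply: mem_nth.
pose chi (m : nat) := \prod_(i : I) F (q i) m.
have chiE m : chi m = \prod_(r <- s) F r m by rewrite (big_nth 0%N) big_mkord.
have [||||||||||||m] := @exists_prescribed_characters I q (fun i => F (q i)) (fun i => E (q i)) n.
- by move=> i; apply: qchar_mod_gt0 (Fs _ (qs i)).
- by move=> i j ij; apply: cs => //; rewrite nth_uniq.
- by move=> i; apply: qcharM (Fs _ (qs i)).
- by move=> i; apply: qchar_mod (Fs _ (qs i)).
- by move=> i; apply: qchar_val (Fs _ (qs i)).
- by move=> i; apply: qchar_eq0 (Fs _ (qs i)).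
- by move=> i; apply: qchar_neg (Fs _ (qs i)).
- by move=> i; apply: Es.
- by rewrite -[RHS]prodE [RHS](big_nth 0%N) [RHS]big_mkord.
- exact: n0.
(* If [p] did not divide [y], the congruence of [x ^ 2] and [- n y ^ 2] would contradict
   [(- n / p) = -1]. *)
- move=> p x y p_pr p_odd; rewrite -/(chi p) chiE chiP // => leg pxy.
  have py : (p %| y)%N.
    apply/negPn/negP => py.
    have pd : (p %| x%:Z ^+ 2 - (- n%:Z) * y%:Z ^+ 2)%Z by rewrite mulNr opprK.
    have := legendre_mod p_pr pd.
    rewrite (legendreM p_pr p_odd (- n%:Z)) leg (@legendre_sqr p p_pr p_odd y py).
    rewrite expr2 legendreM //.
    by have := legendre_val p x; rewrite !inE => /or3P[]/eqP->.
  rewrite py andbT; move: pxy; rewrite dvdn_addl; first by rewrite Euclid_dvdX // => /andP[].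
  by rewrite dvdn_mull // dvdn_exp.
- by rewrite card_ord lt0n size_eq0.
case=> m0 mE meven.
have [k [r [k0 r0 sqr Em]]] := sqfree_decomposition m0.
have mE' p : p \in s -> F p m = E p.
  by case/(nthP 0%N) => i hi <-; apply: (mE (Ordinal hi)).
have FE p : p \in s -> F p m = F p r.
  move=> ps; have := Es p ps; rewrite -(mE' p ps) Em (qcharM (Fs p ps)) -mulnn (qcharM (Fs p ps)).
  by have := qchar_val (Fs p ps) k; rewrite !inE => /or3P[]/eqP->; rewrite ?mulr1 ?mul1r ?mulrNN ?mulr1 ?mul1r // !mul0r.
have chi_r p : prime p -> (p %| r)%N -> chi p = 1.
  move=> p_pr pr.
  have : chi p \in [:: 0; 1; -1].
    rewrite /chi; elim/big_ind: _ => // [a b|i _]; last exact: qchar_val (Fs _ (qs i)) p.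
    by rewrite !inE => /or3P[]/eqP-> /or3P[]/eqP->.
  have c0 : chi p != 0.
    apply/prodf_neq0 => i _; have := Es _ (qs i); rewrite -(mE' _ (qs i)) FE //.
    have [c ->] := dvdnP pr; rewrite (qcharM (Fs _ (qs i))).
    by apply: contraTneq => ->; rewrite mulr0.
  have c1 : chi p <> -1.
    move=> /(meven p p_pr); rewrite Em lognM ?expn_gt0 ?k0 // lognX (sqfree_logn p_pr r0 sqr pr).
    by rewrite oddD oddM.
  by rewrite !inE => /or3P[/eqP c|/eqP//|/eqP//]; rewrite c in c0.
have r_odd : odd r.
  rewrite -[odd r]negbK -dvdn2; apply: contra chi2 => r2.
  by rewrite -chiE; apply/eqP/chi_r.
exists r; split=> //; first by move=> p ps; rewrite -FE ?mE'.
apply: sqfree_crt => // p p_pr pr.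
have p_odd : odd p by have [c Ec] := dvdnP pr; move: r_odd; rewrite Ec oddM => /andP[].
have := chi_r p p_pr pr; rewrite chiE chiP // => /(legendre_sqrt p_pr p_odd)[t].
by rewrite opprK; exists t.
Qed.

(** * Three squares for [n] and [2 n], with [n] odd and squarefree *)

Section OddSquarefree.
Variable n : nat.
Hypotheses (n_gt0 : (0 < n)%N) (n_odd : odd n) (n_sqfree : sqfree n).

Lemma primes_odd (p : nat) : p \in primes n -> prime p /\ odd p.
Proof.
rewrite mem_primes => /and3P[p_pr _ /dvdnP[c Ec]]; split=> //.
by move: n_odd; rewrite Ec oddM => /andP[].
Qed.

Lemma prod_primes_multiplicative (g : nat -> int) : g 1%N = 1 ->
  (forall x y, g (x * y)%N = g x * g y) -> \prod_(q <- primes n) g q = g n.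
Proof. by move=> g1 gM; rewrite -{2}(prod_primes_sqfree n_gt0 n_sqfree) (big_morph g gM g1). Qed.

(** Reciprocity multiplied over the primes of [n]; a factor [q = p] vanishes on both sides. *)
Lemma reciprocity_sqfree (p : nat) : prime p -> odd p ->
  \prod_(q <- primes n) legendre q p = legendre p n * (if (p %% 4 == 3)%N then chi4 n else 1).
Proof.
move=> p_pr p_odd.
rewrite -(prod_primes_multiplicative (g := fun x => legendre p x));
  [|exact: legendre1|by move=> x y; rewrite PoszM legendreM].
have -> : (if (p %% 4 == 3)%N then chi4 n else 1)
    = \prod_(q <- primes n) (if (p %% 4 == 3)%N then chi4 q else 1).
  case: ifP => _; last by rewrite big1.
  by rewrite prod_primes_multiplicative //; case: chi4_quadratic_character.
rewrite -big_split /=; apply: eq_big_seq => q /primes_odd[q_pr q_odd].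
have [->|pq] := eqVneq p q.
  have -> : legendre q q = 0 by apply/eqP; rewrite legendre_eq0 // dvdzz.
  by rewrite mul0r.
have := quadratic_reciprocity p_pr q_pr p_odd q_odd pq.
rewrite -signr_odd oddM.
have := legendre_val p q; have := legendre_val q p.
have qp : ~~ (q %| p)%N by rewrite dvdn_prime2 // eq_sym.
have : legendre q p != 0 by rewrite legendre_eq0.
have -> : odd p./2 = (p %% 4 == 3)%N.
  by have : (p %% 4 = 1 \/ p %% 4 = 3)%N by [lia]; case=> h; rewrite h /=; lia.
have -> : chi4 q = (-1) ^+ odd q./2.
  rewrite /chi4; have : (q %% 4 = 1 \/ q %% 4 = 3)%N by lia.
  by case=> h; rewrite h /=; [have -> : odd q./2 = false by lia | have -> : odd q./2 by lia].
case: (p %% 4 == 3)%N => /=; case: (odd q./2); rewrite !inE => h0 /or3P[]/eqP E1 /or3P[]/eqP E2;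
  by move: h0; rewrite E1 E2.
Qed.

Lemma legendre_opp_neq0 (j p : nat) : j \in [:: 1; 2]%N -> p \in primes n ->
  legendre p (- j%:Z) != 0.
Proof.
move=> hj pn; have [p_pr p_odd] := primes_odd pn; rewrite legendre_eq0 //.
have : ~~ (p %| j)%N; last by apply: contra; rewrite rpredN.
move: hj; rewrite !inE => /orP[]/eqP->; first by rewrite dvdn1; apply: contraTneq p_pr => ->.
by rewrite dvdn_prime2 //; apply: contraTneq p_odd => ->.
Qed.

(* For [n = 3 mod 8] reciprocity excludes an odd modulus in [sum3sq_criterion]; hence the factor [j]. *)
Lemma sum3sq_of_residue (N m j : nat) : (N, j) \in [:: (n, 1); (n, 2); (2 * n, 1)]%N ->
  (0 < m)%N -> odd m -> (exists t : int, (m %| t ^+ 2 + N)%Z) ->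
  {in primes n, forall p, legendre p m = legendre p (- j%:Z)} -> sum3sq N.
Proof.
move=> Nj m0 m_odd [t ht] leg_m.
have [N0 j0] : (0 < N)%N /\ (0 < j)%N.
  by move: Nj; rewrite !inE => /or3P[]/eqP[-> ->] //; rewrite muln_gt0.
have j12 : j \in [:: 1; 2]%N by move: Nj; rewrite !inE => /or3P[]/eqP[_ ->].
have leg_j p pn := @legendre_opp_neq0 j p j12 pn.
have cop_mn : coprime m n.
  rewrite -(prod_primes_sqfree n_gt0 n_sqfree) big_seq.
  elim/big_ind: _ => [|a b ca cb|p pn]; rewrite ?coprimen1 ?coprimeMr ?ca //.
  have [p_pr p_odd] := primes_odd pn; rewrite coprime_sym prime_coprime //.
  have := leg_j p pn; rewrite -leg_m // legendre_eq0 //.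
have cop_2n : coprime 2 n by rewrite coprime2n.
have cop_2m : coprime m 2 by rewrite coprimen2.
have cop : coprime (j * m) N.
  by move: Nj; rewrite !inE => /or3P[]/eqP[-> ->]; rewrite ?mul1n ?coprimeMl ?coprimeMr ?cop_2m ?cop_2n ?cop_mn.
have [t' ht'] : exists t' : int, ((j * m)%N %| t' ^+ 2 + N)%Z.
  move: Nj; rewrite !inE => /or3P[]/eqP[EN ->]; rewrite ?mul1n; [by exists t| |by exists t].
  (* Adding the odd [m] if necessary makes the root odd, so that [t1 ^ 2 + N] is even as well. *)
  have [t1 t1_odd ht1] : exists2 t1 : int, (2 %| t1 - 1)%Z & (m %| t1 ^+ 2 + N)%Z.
    have [t_odd|t_even] := boolP (2 %| t - 1)%Z; first by exists t.
    exists (t + m%:Z); first by move: t_even m_odd; clear; lia.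
    have -> : (t + m%:Z) ^+ 2 + N = (t ^+ 2 + N) + m%:Z * (2 * t + m%:Z) by ring.
    by apply: rpredD => //; apply: dvdz_mulr.
  exists t1; rewrite PoszM Gauss_dvdz; last by rewrite coprimezE coprime_sym.
  rewrite ht1 andbT.
  have -> : t1 ^+ 2 + N = (t1 - 1) * (t1 + 1) + (1 + N)%N by rewrite PoszD; ring.
  apply: rpredD; first exact: dvdz_mulr.
  by rewrite EN -[(_ %| _)%Z]/((2 %| 1 + n)%N) dvdn2 /= n_odd.
have sqN : sqfree N.
  move: Nj; rewrite !inE => /or3P[]/eqP[-> _] // p p_pr.
  apply/negP => pn; have [p2|p_odd] := even_prime p_pr.
    by move: pn; rewrite p2 -mulnn dvdn_pmul2l // dvdn2 n_odd.
  have := n_sqfree p_pr; rewrite -(@Gauss_dvdr _ 2) ?pn //.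
  by rewrite coprimeXl // coprimen2.
(* At a prime of [n] the symbol of [- j * m] is that of [- j] squared; at 2, which divides only
   [N = 2 n], the root 1 works because [m] is odd. *)
have [u hu] : exists u : int, (N %| u ^+ 2 + (j * m)%N)%Z.
  apply: sqfree_crt => // p p_pr pN.
  have [pn|pn] := boolP (p \in primes n).
    have [_ p_odd] := primes_odd pn.
    have : legendre p (- (j * m)%N%:Z) = 1.
      rewrite PoszM -mulNr legendreM // leg_m //.
      by have := leg_j p pn; have := legendre_val p (- j%:Z); rewrite !inE => /or3P[]/eqP->.
    by case/(legendre_sqrt p_pr p_odd) => u; rewrite opprK; exists u.
  have pn' : ~~ (p %| n)%N by move: pn; rewrite mem_primes p_pr n_gt0.
  move: Nj pN; rewrite !inE => /or3P[]/eqP[-> ->]; rewrite ?(negPf pn') //.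
  rewrite Euclid_dvdM // (negPf pn') orbF dvdn_prime2 // => /eqP ->.
  exists 1; rewrite mul1n expr1n -[_ + _]/(Posz (1 + m)) -[(_ %| _)%Z]/((2 %| 1 + m)%N).
  by rewrite dvdn2 /= m_odd.
have copz : coprimez (j * m)%N N by rewrite coprimezE.
by apply: (sum3sq_criterion _ _ copz ht' hu); rewrite ltz_nat ?muln_gt0 ?j0.
Qed.

(** Local data at the primes of [n], together with at most one character [c2] at 2, whose modulus 4
    or 8 is listed in [ts]. *)
Lemma sum3sq_of_characters (N j : nat) (ts : seq nat) (c2 : nat -> int) (e2 : int) :
  (N, j) \in [:: (n, 1); (n, 2); (2 * n, 1)]%N ->
  ts \in [:: [::]; [:: 4]; [:: 8]] -> ts ++ primes n != [::] ->
  {in ts, forall q, quadratic_character q c2} -> e2 \in [:: 1; -1] ->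
  (\prod_(q <- ts) e2) * \prod_(p <- primes n) legendre p (- j%:Z) = 1 ->
  (forall p, prime p -> odd p ->
    (\prod_(q <- ts) c2 p) * \prod_(q <- primes n) legendre q p = legendre p (- N%:Z)) ->
  (\prod_(q <- ts) c2 2%N) * \prod_(q <- primes n) legendre q 2 != 1 ->
  sum3sq N.
Proof.
move=> Nj hts s0 c2P e2P prodE chiP chi2.
have N0 : (0 < N)%N by move: Nj; rewrite !inE => /or3P[]/eqP[-> _] //; rewrite muln_gt0.
have j12 : j \in [:: 1; 2]%N by move: Nj; rewrite !inE => /or3P[]/eqP[_ ->].
have ts_even q : q \in ts -> exists2 e, (0 < e)%N & q = (2 ^ e)%N.
  by move: hts; rewrite !inE => /or3P[]/eqP-> //; rewrite inE => /eqP->; [exists 2 | exists 3].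
have ts_neven q : q \in ts -> odd q = false by move/ts_even=> [[|e] // _ ->]; rewrite oddX.
(* The parity of the modulus tells the primes of [n] from the modulus at 2. *)
pose F q m := if odd q then legendre q m%:Z else c2 m.
pose E q := if odd q then legendre q (- j%:Z) else e2.
have prod_split (A : nat -> int) (c : int) :
    \prod_(q <- ts ++ primes n) (if odd q then A q else c)
    = (\prod_(q <- ts) c) * \prod_(q <- primes n) A q.
  rewrite big_cat /=; congr (_ * _); apply: eq_big_seq => q.
    by move/ts_neven ->.
  by case/primes_odd => _ ->.
have [|||||||||m [m0 _ m_odd mE [t ht]]] := @exists_split_residue N (ts ++ primes n) F E.
- exact: N0.
- exact: s0.
- rewrite cat_uniq primes_uniq andbT; apply/andP; split.
    by move: hts; rewrite !inE => /or3P[]/eqP->.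
  by apply/hasPn => q /primes_odd[_ q_odd]; apply/negP => /ts_neven; rewrite q_odd.
- have cop2 q r : q \in ts -> r \in primes n -> coprime q r.
    by move=> /ts_even[e e0 ->] /primes_odd[_ r_odd]; rewrite coprimeXl // coprime2n.
  move=> q r; rewrite !mem_cat => /orP[qt|qn] /orP[rt|rn] qr.
  + by move: hts qt rt qr; rewrite !inE => /or3P[]/eqP-> //; rewrite !inE => /eqP-> /eqP->.
  + exact: cop2.
  + by rewrite coprime_sym; apply: cop2.
  + have [q_pr _] := primes_odd qn; have [r_pr _] := primes_odd rn.
    by rewrite prime_coprime // dvdn_prime2.
- move=> q; rewrite mem_cat /F => /orP[qt|/primes_odd[q_pr q_odd]].
    by rewrite (ts_neven q qt); apply: c2P.
  by rewrite q_odd; apply: legendre_quadratic_character.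
- move=> q; rewrite mem_cat /E => /orP[qt|qn].
    by rewrite (ts_neven q qt).
  have [_ ->] := primes_odd qn; have := legendre_opp_neq0 j12 qn.
  by have := legendre_val q (- j%:Z); rewrite !inE; case: eqP.
- by rewrite prod_split.
- by move=> p p_pr p_odd; rewrite prod_split chiP.
- by rewrite prod_split.
apply: (sum3sq_of_residue Nj m0 m_odd (ex_intro _ t ht)) => p pn.
have := mE p; rewrite /F /E mem_cat pn orbT => /(_ isT).
by have [_ ->] := primes_odd pn.
Qed.

(** Discriminant [- 4 n]: [chi4] vanishes at 2, and the symbols [(-1 / p)] multiply to
    [chi4 n = 1]. *)
Lemma sum3sq_1mod4 : (n %% 4 = 1)%N -> sum3sq n.
Proof.
move=> n4; have c4n : chi4 n = 1 by rewrite /chi4 n4.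
apply: (@sum3sq_of_characters n 1 [:: 4] chi4 1) => //.
- by rewrite !inE eqxx ?orbT.
- by move=> q; rewrite inE => /eqP ->; apply: chi4_quadratic_character.
- rewrite big_seq1 mul1r -[RHS]c4n -(prod_primes_multiplicative (g := chi4)) //.
    by apply: eq_big_seq => p /primes_odd[p_pr p_odd]; rewrite legendreN1.
  by case: chi4_quadratic_character.
- move=> p p_pr p_odd; rewrite big_seq1 reciprocity_sqfree // c4n if_same mulr1.
  by rewrite -legendreN1 // -legendreM // mulN1r.
- by rewrite big_seq1 mul0r.
Qed.

(** Discriminant [- n]: the full character at 2 is [chi8 n = -1], and the symbols [(-2 / p)]
    multiply to [chim8 n = 1]. *)
Lemma sum3sq_3mod8 : (n %% 8 = 3)%N -> sum3sq n.
Proof.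
move=> n8; have c4n : chi4 n = -1 by rewrite /chi4 -(@modn_dvdm 8) // n8.
have c8n : chi8 n = -1 by rewrite /chi8 n8.
apply: (@sum3sq_of_characters n 2 [::] chi4 1) => //.
- by rewrite !inE eqxx ?orbT.
- apply: contra_eq_neq n8 => /= n1.
  by rewrite -(prod_primes_sqfree n_gt0 n_sqfree) n1 big_nil.
- rewrite big_nil mul1r; transitivity (chim8 n); last by rewrite /chim8 c4n c8n.
  rewrite -(prod_primes_multiplicative (g := chim8)) //; last by case: chim8_quadratic_character.
  apply: eq_big_seq => p /primes_odd[p_pr p_odd].
  by rewrite -mulN1r legendreM // legendreN1 // legendre2.
- move=> p p_pr p_odd; rewrite big_nil mul1r reciprocity_sqfree // c4n.
  rewrite -(mulN1r n%:Z) legendreM // mulrC legendreN1 //; congr (_ * _); rewrite /chi4.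
  by have : (p %% 4 = 1 \/ p %% 4 = 3)%N by [lia]; case=> ->.
- rewrite big_nil mul1r; have -> : \prod_(q <- primes n) legendre q 2 = chi8 n; last by rewrite c8n.
  rewrite -(prod_primes_multiplicative (g := chi8)) //; last by case: chi8_quadratic_character.
  by apply: eq_big_seq => p /primes_odd[p_pr p_odd]; rewrite legendre2.
Qed.

(** Discriminant [- 8 n], with [chim8] or [chi8] at 2 according to [n] modulo 4; in the second case
    the value -1 at 2 compensates [chi4 n = -1]. *)
Lemma sum3sq_2mod4 : sum3sq (2 * n)%N.
Proof.
have prodN1 : \prod_(p <- primes n) legendre p (- 1%:Z) = chi4 n.
  rewrite -(prod_primes_multiplicative (g := chi4)) //; last by case: chi4_quadratic_character.
  by apply: eq_big_seq => p /primes_odd[p_pr p_odd]; rewrite legendreN1.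
have legN2n p : prime p -> odd p ->
    legendre p (- (2 * n)%N%:Z) = chi4 p * chi8 p * legendre p n.
  by move=> p_pr p_odd; rewrite PoszM -mulN1r mulrA !legendreM // legendreN1 // legendre2.
have : (n %% 4 = 1 \/ n %% 4 = 3)%N by lia.
case=> n4.
  have c4n : chi4 n = 1 by rewrite /chi4 n4.
  apply: (@sum3sq_of_characters (2 * n) 1 [:: 8] chim8 1) => //.
  - by rewrite !inE eqxx !orbT.
  - by move=> q; rewrite inE => /eqP ->; apply: chim8_quadratic_character.
  - by rewrite big_seq1 mul1r prodN1.
  - move=> p p_pr p_odd; rewrite big_seq1 reciprocity_sqfree // c4n if_same mulr1.
    by rewrite legN2n.
  - by rewrite big_seq1 mul0r.
have c4n : chi4 n = -1 by rewrite /chi4 n4.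
apply: (@sum3sq_of_characters (2 * n) 1 [:: 8] chi8 (-1)) => //.
- by rewrite !inE eqxx !orbT.
- by move=> q; rewrite inE => /eqP ->; apply: chi8_quadratic_character.
- by rewrite big_seq1 prodN1 c4n.
- move=> p p_pr p_odd; rewrite big_seq1 reciprocity_sqfree // c4n legN2n //.
  rewrite mulrA [RHS]mulrC mulrC [chi8 p * _]mulrC -mulrA.
  have -> : (if (p %% 4 == 3)%N then -1 else 1) = chi4 p.
    by rewrite /chi4; have : (p %% 4 = 1 \/ p %% 4 = 3)%N by [lia]; case=> ->.
  by ring.
- by rewrite big_seq1 mul0r.
Qed.

End OddSquarefree.

Theorem three_squares (n : nat) : (n %% 8 \in [:: 1; 2; 3; 5; 6])%N -> sum3sq n.
Proof.
move=> n8; have n0 : (0 < n)%N by case: n n8.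
have [k [s [k0 s0 sq En]]] := sqfree_decomposition n0.
rewrite En PoszM -[Posz (k ^ 2)]/(Posz (k * k)) PoszM -expr2; apply: sum3sqM.
(* An even [k] would make [n] divisible by 4; for odd [k], [s] and [n] agree modulo 8. *)
have k_odd : odd k.
  apply/negPn/negP => k_even; have [c Ec] : exists c, k = (2 * c)%N by exists k./2; lia.
  by move: n8; rewrite En Ec expnMn -mulnA -[(2 ^ 2)%N]/4%N !inE; move: (c ^ 2 * s)%N; clear; lia.
have sn : (s %% 8 = n %% 8)%N.
  have k8 : (k ^ 2 %% 8 = 1)%N.
    have : (k %% 8 \in [:: 1; 3; 5; 7])%N by rewrite !inE; lia.
    by rewrite -modnXm !inE => /or4P[]/eqP->.
  by rewrite En -modnMml k8 mul1n.
rewrite -sn in n8; move: s s0 sq n8 {En sn} => s s0 sq s8.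
have [s_odd|s_even] := boolP (odd s).
  have : (s %% 4 = 1 \/ s %% 8 = 3)%N by move: s8 s_odd; rewrite !inE; lia.
  by case=> h; [apply: sum3sq_1mod4 | apply: sum3sq_3mod8].
have [r Er] : exists r, s = (2 * r)%N by exists s./2; lia.
rewrite Er; apply: sum3sq_2mod4.
- by move: s0; rewrite Er muln_gt0.
- by move: s8; rewrite Er !inE; clear; lia.
- by apply: sqfree_dvd sq; rewrite Er dvdn_mull.
Qed.

(** * Restricted four squares *)

(* The four left-hand sides are [7 x], [7 y], [7 z], [7 w] for the solution of
   [s = x + y + z + 2 w], [a = x - y + 2 z - w], [b = x - 2 y - z + w], [c = 2 x + y - z - w],
   a matrix with orthogonal rows of norm 7. *)
Definition mod7_system (s a b c : int) : bool :=
  [&& (7 %| s + a + b + 2 * c)%Z, (7 %| s - a - 2 * b + c)%Z,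
      (7 %| s + 2 * a - b - c)%Z & (7 %| 2 * s - a + b - c)%Z].

Definition signs3 : seq (int * int * int) :=
  [:: (1, 1, 1); (1, 1, -1); (1, -1, 1); (1, -1, -1);
      (-1, 1, 1); (-1, 1, -1); (-1, -1, 1); (-1, -1, -1)].

Definition mod7_solvable (s a b c : int) : bool :=
  has (fun e : int * int * int => let S x y z := mod7_system s (e.1.1 * x) (e.1.2 * y) (e.2 * z) in
    [|| S a b c, S a c b, S b a c, S b c a, S c a b | S c b a]) signs3.

(* The signed permutations of [(a, b, c)] act transitively on the eight left ideals of norm 7
   of the quaternions modulo 7. *)
Lemma mod7_solvable_residues :
  let R : seq int := [seq Posz i | i <- iota 0 7] in
  all (fun s => all (fun a => all (fun b => all (fun c =>
    (7 %| s * s + a * a + b * b + c * c)%Z ==> mod7_solvable s a b c) R) R) R) R.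
Proof. by vm_compute. Qed.

Lemma mod7_solution (n s a b c : int) (e : int * int * int) :
  e \in signs3 -> 7 * n = s ^+ 2 + a ^+ 2 + b ^+ 2 + c ^+ 2 ->
  mod7_system (s %% 7)%Z (e.1.1 * (a %% 7)%Z) (e.1.2 * (b %% 7)%Z) (e.2 * (c %% 7)%Z) ->
  exists x y z w : int, n = x ^+ 2 + y ^+ 2 + z ^+ 2 + w ^+ 2 /\ x + y + z + 2 * w = s.
Proof.
case: e => -[e1 e2] e3 /= he hn.
have [h1 [h2 h3]] : e1 ^+ 2 = 1 /\ e2 ^+ 2 = 1 /\ e3 ^+ 2 = 1.
  by move: he; rewrite !inE => /or4P[|||/or4P[||| /orP[]]] /eqP[-> -> ->].
rewrite /mod7_system => /and4P[/dvdzP[k1 H1] /dvdzP[k2 H2] /dvdzP[k3 H3] /dvdzP[k4 H4]].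
have hs := divz_eq s 7; have ha := divz_eq a 7; have hb := divz_eq b 7; have hc := divz_eq c 7.
move: (s %/ 7)%Z (s %% 7)%Z (a %/ 7)%Z (a %% 7)%Z (b %/ 7)%Z (b %% 7)%Z (c %/ 7)%Z (c %% 7)%Z
  H1 H2 H3 H4 hs ha hb hc => qs s' qa a' qb b' qc c' H1 H2 H3 H4 hs ha hb hc.
pose A := e1 * a; pose B := e2 * b; pose C := e3 * c.
have hN : 7 * n = s ^+ 2 + A ^+ 2 + B ^+ 2 + C ^+ 2.
  by rewrite /A /B /C !exprMn h1 h2 h3 !mul1r.
have hA : A = 7 * (e1 * qa) + e1 * a' by rewrite /A ha; ring.
have hB : B = 7 * (e2 * qb) + e2 * b' by rewrite /B hb; ring.
have hC : C = 7 * (e3 * qc) + e3 * c' by rewrite /C hc; ring.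
(* The quotients found for the residues, corrected by those of [s, a, b, c], solve the system
   exactly. *)
pose x := k1 + qs + e1 * qa + e2 * qb + 2 * (e3 * qc).
pose y := k2 + qs - e1 * qa - 2 * (e2 * qb) + e3 * qc.
pose z := k3 + qs + 2 * (e1 * qa) - e2 * qb - e3 * qc.
pose w := k4 + 2 * qs - e1 * qa + e2 * qb - e3 * qc.
have Hx : 7 * x = s + A + B + 2 * C by rewrite /x hs hA hB hC; clear -H1; lia.
have Hy : 7 * y = s - A - 2 * B + C by rewrite /y hs hA hB hC; clear -H2; lia.
have Hz : 7 * z = s + 2 * A - B - C by rewrite /z hs hA hB hC; clear -H3; lia.
have Hw : 7 * w = 2 * s - A + B - C by rewrite /w hs hA hB hC; clear -H4; lia.
exists x, y, z, w; move: x y z w A B C Hx Hy Hz Hw hN {hA hB hC} => x y z w A B C Hx Hy Hz Hw hN.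
clear -Hx Hy Hz Hw hN.
have Es : s = x + y + z + 2 * w by lia.
have EA : A = x - y + 2 * z - w by lia.
have EB : B = x - 2 * y - z + w by lia.
have EC : C = 2 * x + y - z - w by lia.
split; last by rewrite Es.
apply: (@mulfI _ (7 : int)) => //.
by rewrite hN Es EA EB EC; ring.
Qed.

Lemma four_squares_linear7 (n s : int) : sum3sq (7 * n - s ^+ 2) ->
  exists x y z w : int, n = x ^+ 2 + y ^+ 2 + z ^+ 2 + w ^+ 2 /\ x + y + z + 2 * w = s.
Proof.
case=> a [b [c habc]].
have hn : 7 * n = s ^+ 2 + a ^+ 2 + b ^+ 2 + c ^+ 2 
  by rewrite -[LHS](subrK (s ^+ 2)) habc; ring.
have inR u : (u %% 7)%Z \in [seq Posz i | i <- iota 0 7].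
  have := modz_ge0 u (isT : 7 != 0 :> int); have := ltz_pmod u (isT : 0 < 7 :> int).
  case: (u %% 7)%Z => // v v7 _; apply/mapP; exists v => //; rewrite mem_iota; lia.
have := mod7_solvable_residues.
move=> /allP/(_ _ (inR s))/allP/(_ _ (inR a))/allP/(_ _ (inR b))/allP/(_ _ (inR c)).
have -> : (7 %| (s %% 7)%Z * (s %% 7)%Z + (a %% 7)%Z * (a %% 7)%Z
             + (b %% 7)%Z * (b %% 7)%Z + (c %% 7)%Z * (c %% 7)%Z)%Z.
  rewrite {1}(divz_eq s 7) {1}(divz_eq a 7) {1}(divz_eq b 7) {1}(divz_eq c 7) in hn.
  apply/dvdzP.
  move: (s %/ 7)%Z (s %% 7)%Z (a %/ 7)%Z (a %% 7)%Z (b %/ 7)%Z (b %% 7)%Z (c %/ 7)%Z (c %% 7)%Z hn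
    => qs s' qa a' qb b' qc c' hn.
  exists (n - (7 * qs ^+ 2 + 2 * qs * s') - (7 * qa ^+ 2 + 2 * qa * a')
     - (7 * qb ^+ 2 + 2 * qb * b') - (7 * qc ^+ 2 + 2 * qc * c')).
  by rewrite !mulrBl [n * 7]mulrC hn; ring.
rewrite implyTb => /hasP[e he] /=.
case/or4P=> [H|H|H|/or3P[H|H|H]]; apply: mod7_solution he _ H; rewrite hn; ring.
Qed.

(** A representation of [2 n] has its coordinates in two pairs of equal parity, and half-sums and
    half-differences represent [n]. *)
Lemma four_squares_linear14 (n s : int) : sum3sq (14 * n - s ^+ 2) ->
  exists x y z w : int, n = x ^+ 2 + y ^+ 2 + z ^+ 2 + w ^+ 2 /\ x + 2 * y + 3 * z = s.
Proof.
rewrite (_ : 14 * n = 7 * (2 * n)); last by ring.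
have aux (x y z w : int) : 2 * n = x ^+ 2 + y ^+ 2 + z ^+ 2 + w ^+ 2 ->
    x + y + z + 2 * w = s -> (2 %| x - y)%Z -> (2 %| z - w)%Z ->
    exists x y z w : int, n = x ^+ 2 + y ^+ 2 + z ^+ 2 + w ^+ 2 /\ x + 2 * y + 3 * z = s.
  move=> hn hs /dvdzP[q hq] /dvdzP[v hv].
  have {hq}hq : x = y + 2 * q by lia.
  have {hv}hv : z = w + 2 * v by lia.
  (* These are [(w - z) / 2], [(x + y) / 2], [(z + w) / 2], [(x - y) / 2]. *)
  exists (- v), (y + q), (w + v), q; subst x z; split; last by rewrite -hs; ring.
    by apply: (@mulfI _ (2 : int)) => //; rewrite hn; ring.
move/four_squares_linear7=> [x [y [z [w [hn hs]]]]].
have sqr_parity (v : int) : exists k, v ^+ 2 = v + 2 * k.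
  have := divz_eq v 2; have := modz_ge0 v (isT : 2 != 0 :> int).
  have := ltz_pmod v (isT : 0 < 2 :> int).
  move: (v %/ 2)%Z (v %% 2)%Z => q r r2 r0 ->.
  have [->|->] : r = 0 \/ r = 1 by lia.
  - by exists (2 * q ^+ 2 - q); ring.
  - by exists (2 * q ^+ 2 + q); ring.
have par : exists k, x + y + z + w = 2 * k.
  have [kx hx] := sqr_parity x; have [ky hy] := sqr_parity y.
  have [kz hz] := sqr_parity z; have [kw hw] := sqr_parity w.
  by exists (n - kx - ky - kz - kw); rewrite !mulrBr hn hx hy hz hw; ring.
case: par => k par.
(* Two of [x, y, z], which are interchangeable in the linear form, have equal parity; the third then
   agrees with [w]. *)
have [h1 | h1] := boolP (2 %| x - y)%Z; last have [h2 | h2] := boolP (2 %| x - z)%Z.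
- by apply: (aux x y z w) => //; clear -par h1; lia.
- apply: (aux x z y w) => //; [by rewrite hn; ring | by rewrite -hs; ring | clear -par h1 h2; lia].
- apply: (aux y z x w) => //; [by rewrite hn; ring | by rewrite -hs; ring | |]; clear -par h1 h2; lia.
Qed.

Lemma three_squares_pow4 (k d : nat) (N : int) : N = 4 ^+ k * d%:Z ->
  (d %% 8 \in [:: 1; 2; 3; 5; 6])%N -> sum3sq N.
Proof.
move=> -> d8; have -> : 4 ^+ k = (2 ^+ k) ^+ 2 :> int by rewrite -exprM mulnC exprM.
exact/sum3sqM/three_squares.
Qed.

Lemma PoszM_pow4 (k c : nat) : (4 ^ k * c)%N%:Z = 4 ^+ k * c%:Z.
Proof. by rewrite PoszM; congr (_ * _); elim: k => // k IH; rewrite expnS exprS PoszM IH. Qed.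

Lemma pow4_decomposition (n : nat) : (0 < n)%N ->
  exists k c : nat, n = (4 ^ k * c)%N /\ (c %% 4 != 0)%N.
Proof.
have [l] := ubnP n; elim: l n => // l IH n nl n0.
have [n4|n4] := eqVneq (n %% 4)%N 0%N; last by exists 0%N, n; rewrite expn0 mul1n.
have [||k [c [E c4]]] := IH (n %/ 4)%N; [by lia | by lia |].
by exists k.+1, c; split=> //; rewrite expnS -mulnA -E; lia.
Qed.

(** Scaling by [(2 ^ a) ^ m] multiplies [n] by [4 ^ (a m)] and keeps [lambda] times an [m]-th power,
    so only [k] modulo [m] matters. *)
Lemma scaled_linear_power (ell : int -> int -> int -> int -> int) (lambda m : nat) :
  (0 < m)%N ->
  (forall k x y z w, ell (k * x) (k * y) (k * z) (k * w) = k * ell x y z w) ->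
  (forall k c, (k < m)%N -> (c %% 4 != 0)%N -> exists r : nat, exists x y z w : int,
     (4 ^ k * c)%N%:Z = x ^+ 2 + y ^+ 2 + z ^+ 2 + w ^+ 2 /\
     ell x y z w = lambda%:Z * r%:Z ^+ m) ->
  forall n : nat, exists x y z w : int,
    n%:Z = x ^+ 2 + y ^+ 2 + z ^+ 2 + w ^+ 2 /\
    exists r : nat, ell x y z w = lambda%:Z * r%:Z ^+ m.
Proof.
move=> m0 ellM base n; have [->|n0] := posnP n.
  exists 0, 0, 0, 0; split=> //; exists 0%N.
  by have := ellM 0 0 0 0 0; rewrite !mul0r expr0n -[m == 0%N]negbK -lt0n m0 mulr0.
have [k [c [-> c4]]] := pow4_decomposition n0.
have [r [x [y [z [w [E1 E2]]]]]] := base (k %% m)%N c (ltn_pmod _ m0) c4.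
pose a := (k %/ m)%N; pose t : int := (2 ^+ a) ^+ m.
exists (t * x), (t * y), (t * z), (t * w); split; last first.
  exists (2 ^ a * r)%N; rewrite ellM E2 PoszM exprMn mulrCA /t; congr (_ * (_ ^+ _ * _)).
  by elim: (a) => // b IH; rewrite expnS exprS PoszM IH.
have tt : t ^+ 2 = 4 ^+ (a * m) by rewrite /t -!exprM mulnA [(a * m * 2)%N]mulnC exprM.
by rewrite !exprMn -!mulrDr -E1 tt {1}(divn_eq k m) -/a expnD -mulnA PoszM_pow4.
Qed.

(* [7 (4 ^ k c)] is itself a sum of three squares unless [c = 1 mod 8]. *)
Lemma sum3sq_7n_sub_sqr (lambda m k c : nat) :
  (lambda \in [:: 1; 2])%N -> (m \in [:: 2; 3])%N -> (k < m)%N -> (c %% 4 != 0)%N ->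
  exists r : nat, sum3sq (7 * (4 ^ k * c)%N%:Z - (lambda%:Z * r%:Z ^+ m) ^+ 2).
Proof.
move=> hl hm km c4; have [c1|c1] := eqVneq (c %% 8)%N 1%N; last first.
  exists 0%N; apply: (@three_squares_pow4 k (7 * c)); last by rewrite !inE; lia.
  have -> : (0%:Z ^+ m) = 0 by rewrite expr0n; case: m hm {km}.
  by rewrite mulr0 expr0n subr0 PoszM_pow4 PoszM mulrCA.
have c0 : (0 < c)%N by lia.
have k3 : (k < 3)%N by move: hm km; rewrite !inE => /orP[]/eqP->; lia.
case: k k3 km => [|[|[|]]] // _ km; rewrite ?expn0 ?expn1 -?[(4 ^ 2)%N]/16%N; move: hl hm km;
  rewrite !inE => /orP[]/eqP-> /orP[]/eqP-> // _.
(* Cases ordered by [k], [lambda], [m]. As [c = 1] modulo 8, the cofactors [7 c - 1], [7 c - 4],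
   [28 c - 1] are 6, 3, 3 modulo 8. *)
- by exists 1%N; apply: (@three_squares_pow4 0%N (7 * c - 1)%N); [lia | rewrite !inE; lia].
- by exists 1%N; apply: (@three_squares_pow4 0%N (7 * c - 1)%N); [lia | rewrite !inE; lia].
- by exists 1%N; apply: (@three_squares_pow4 0%N (7 * c - 4)%N); [lia | rewrite !inE; lia].
- by exists 1%N; apply: (@three_squares_pow4 0%N (7 * c - 4)%N); [lia | rewrite !inE; lia].
- by exists 1%N; apply: (@three_squares_pow4 0%N (28 * c - 1)%N); [lia | rewrite !inE; lia].
- by exists 1%N; apply: (@three_squares_pow4 0%N (28 * c - 1)%N); [lia | rewrite !inE; lia].
- by exists 1%N; apply: (@three_squares_pow4 1%N (7 * c - 1)%N); [lia | rewrite !inE; lia].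
- by exists 1%N; apply: (@three_squares_pow4 1%N (7 * c - 1)%N); [lia | rewrite !inE; lia].
- by exists 2%N; apply: (@three_squares_pow4 2%N (7 * c - 4)%N); [lia | rewrite !inE; lia].
- by exists 1%N; apply: (@three_squares_pow4 1%N (28 * c - 1)%N); [lia | rewrite !inE; lia].
Qed.

(* [14 (4 ^ k c)] is itself a sum of three squares unless [c = 2 mod 16]. *)
Lemma sum3sq_14n_sub_sqr (lambda m k c : nat) :
  (lambda \in [:: 1; 2; 4])%N -> (m \in [:: 2; 3])%N -> (k < m)%N -> (c %% 4 != 0)%N ->
  exists r : nat, sum3sq (14 * (4 ^ k * c)%N%:Z - (lambda%:Z * r%:Z ^+ m) ^+ 2).
Proof.
move=> hl hm km c4; have [c1|c1] := eqVneq (c %% 16)%N 2%N; last first.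
  exists 0%N; have -> : (0%:Z ^+ m) = 0 by rewrite expr0n; case: m hm {km}.
  have -> : 14 * (4 ^ k * c)%N%:Z - (lambda%:Z * 0) ^+ 2 = 4 ^+ k * (14 * c)%N%:Z.
    by rewrite mulr0 expr0n subr0 PoszM_pow4 PoszM mulrCA.
  have [c_odd|c_even] := boolP (odd c).
    by apply: (@three_squares_pow4 k (14 * c)) => //; rewrite !inE; lia.
  (* Here [c] is twice an odd number, so [14 c] is 4 times [7 * c./2]. *)
  apply: (@three_squares_pow4 k.+1 (7 * c./2)); last by rewrite !inE; lia.
  by rewrite exprSr -mulrA; congr (_ * _); lia.
have [u [Ec u1]] : exists u, c = (2 * u)%N /\ (u %% 8 = 1)%N by exists c./2; lia.
have u0 : (0 < u)%N by lia.
rewrite {c c4 c1}Ec.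
have k3 : (k < 3)%N by move: hm km; rewrite !inE => /orP[]/eqP->; lia.
case: k k3 km => [|[|[|]]] // _ km; rewrite ?expn0 ?expn1 -?[(4 ^ 2)%N]/16%N; move: hl hm km;
  rewrite !inE => /or3P[]/eqP-> /orP[]/eqP-> // _.
(* Each [r] leaves, up to a power of 4, [28 u - 1], [7 u - 1] or [7 u - 4], which are 3, 6, 3 modulo
   8. *)
- by exists 1%N; apply: (@three_squares_pow4 0%N (28 * u - 1)%N); [lia | rewrite !inE; lia].
- by exists 1%N; apply: (@three_squares_pow4 0%N (28 * u - 1)%N); [lia | rewrite !inE; lia].
- by exists 1%N; apply: (@three_squares_pow4 1%N (7 * u - 1)%N); [lia | rewrite !inE; lia].
- by exists 1%N; apply: (@three_squares_pow4 1%N (7 * u - 1)%N); [lia | rewrite !inE; lia].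
- by exists 1%N; apply: (@three_squares_pow4 1%N (7 * u - 4)%N); [lia | rewrite !inE; lia].
- by exists 1%N; apply: (@three_squares_pow4 1%N (7 * u - 4)%N); [lia | rewrite !inE; lia].
- by exists 2%N; apply: (@three_squares_pow4 2%N (7 * u - 1)%N); [lia | rewrite !inE; lia].
- by exists 2%N; apply: (@three_squares_pow4 2%N (7 * u - 4)%N); [lia | rewrite !inE; lia].
- by exists 1%N; apply: (@three_squares_pow4 1%N (28 * u - 1)%N); [lia | rewrite !inE; lia].
- by exists 1%N; apply: (@three_squares_pow4 1%N (28 * u - 1)%N); [lia | rewrite !inE; lia].
- by exists 1%N; apply: (@three_squares_pow4 2%N (7 * u - 1)%N); [lia | rewrite !inE; lia].
- by exists 1%N; apply: (@three_squares_pow4 2%N (7 * u - 1)%N); [lia | rewrite !inE; lia].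
- by exists 2%N; apply: (@three_squares_pow4 3%N (7 * u - 1)%N); [lia | rewrite !inE; lia].
- by exists 2%N; apply: (@three_squares_pow4 3%N (7 * u - 4)%N); [lia | rewrite !inE; lia].
- by exists 1%N; apply: (@three_squares_pow4 2%N (28 * u - 1)%N); [lia | rewrite !inE; lia].
Qed.

(** Only a cofactor [c = 7] modulo 8 fails, and then [7 c] and [14 c] are 1 and 2 modulo 8. The
    alternatives provide [w = 0] or a vanishing linear form. *)
Lemma three_squares_or_7mod8 (n : nat) : sum3sq n \/ sum3sq (7 * n%:Z) /\ sum3sq (14 * n%:Z).
Proof.
have [->|n0] := posnP n; first by left; exists 0, 0, 0.
have [k [c [En c4]]] := pow4_decomposition n0.
have E : n%:Z = 4 ^+ k * c%:Z by rewrite En PoszM_pow4.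
have [c7|c7] := eqVneq (c %% 8)%N 7%N; last first.
  by left; apply: (@three_squares_pow4 k c) => //; rewrite !inE; lia.
right; split.
  apply: (@three_squares_pow4 k (7 * c)); last by rewrite !inE; lia.
  by rewrite E PoszM mulrCA.
apply: (@three_squares_pow4 k (14 * c)); last by rewrite !inE; lia.
by rewrite E PoszM mulrCA.
Qed.

Theorem theorem1p7 :
  (forall n : nat, exists x y z w : int,
     n%:Z = x ^+ 2 + y ^+ 2 + z ^+ 2 + w ^+ 2 /\
     w * (x + y + z + 2 * w) = 0)
  /\
  (forall lambda m : nat,
     lambda = 1%N \/ lambda = 2%N ->
     m = 2%N \/ m = 3%N ->
     forall n : nat, exists x y z w : int,
       n%:Z = x ^+ 2 + y ^+ 2 + z ^+ 2 + w ^+ 2 /\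
       exists r : nat, x + y + z + 2 * w = lambda%:Z * r%:Z ^+ m)
  /\
  (forall n : nat, exists x y z w : int,
     n%:Z = x ^+ 2 + y ^+ 2 + z ^+ 2 + w ^+ 2 /\
     w * (x + 2 * y + 3 * z) = 0)
  /\
  (forall lambda m : nat,
     lambda = 1%N \/ lambda = 2%N \/ lambda = 4%N ->
     m = 2%N \/ m = 3%N ->
     forall n : nat, exists x y z w : int,
       n%:Z = x ^+ 2 + y ^+ 2 + z ^+ 2 + w ^+ 2 /\
       exists r : nat, x + 2 * y + 3 * z = lambda%:Z * r%:Z ^+ m).
Proof.
split=> [n|]; last split=> [lambda m hl hm|]; last split=> [n|lambda m hl hm].
- have [[x [y [z E]]]|[h _]] := three_squares_or_7mod8 n.
    by exists x, y, z, 0; rewrite expr0n addr0 mul0r.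
  have [|x [y [z [w [E1 E2]]]]] := @four_squares_linear7 n 0; first by rewrite expr0n subr0.
  by exists x, y, z, w; rewrite E2 mulr0.
- have hl' : (lambda \in [:: 1; 2])%N by rewrite !inE; case: hl => ->.
  have hm' : (m \in [:: 2; 3])%N by rewrite !inE; case: hm => ->.
  apply: (@scaled_linear_power (fun x y z w => x + y + z + 2 * w)).
  + by case: hm => ->.
  + by move=> k x y z w; ring.
  move=> k c km c4; have [r h] := sum3sq_7n_sub_sqr hl' hm' km c4.
  by exists r; apply: four_squares_linear7.
- have [[x [y [z E]]]|[_ h]] := three_squares_or_7mod8 n.
    by exists x, y, z, 0; rewrite expr0n addr0 mul0r.
  have [|x [y [z [w [E1 E2]]]]] := @four_squares_linear14 n 0; first by rewrite expr0n subr0.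
  by exists x, y, z, w; rewrite E2 mulr0.
- have hl' : (lambda \in [:: 1; 2; 4])%N by rewrite !inE; case: hl => [->|[]->].
  have hm' : (m \in [:: 2; 3])%N by rewrite !inE; case: hm => ->.
  apply: (@scaled_linear_power (fun x y z w => x + 2 * y + 3 * z)).
  + by case: hm => ->.
  + by move=> k x y z w; ring.
  move=> k c km c4; have [r h] := sum3sq_14n_sub_sqr hl' hm' km c4.
  by exists r; apply: four_squares_linear14.
Qed.
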